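(* Let $t_0\in\mathbb{R}$, let $\ell_0,\ell_1,f\in V$, let $\sigma\in\Sigma$ and $\ell_0\in V_{t_0}(\sigma)$. Suppose $f(0)(t)=0$ for a.e. $t\le t_0$, and that there exists $\kappa>0$ such that: (i) $f(v)(t)\ge 0$ for a.e. $t\le t_0$ and every $v\in C_0(\mathbb{R};[0,\kappa])$; (ii) $f(v)(t)\,\operatorname{sgn} v(t)\le q(t,\|v\|)$ for a.e. $t\ge t_0$ and every $v\in C_0(\mathbb{R};\mathbb{R})$ with $0\le v(t_0)\le\kappa$ and $-\kappa\le v(t)\le\kappa$ for $t\le t_0$, where $q\in K_{loc}([t_0,+\infty)\times\mathbb{R}_+;\mathbb{R}_+)$ is nondecreasing in the second argument and satisfies $\lim_{x\to+\infty}\frac1x\int_{t_0}^b q(s,x)\,ds=0$ for every $b>t_0$; (iii) $\ell_0(v)(t)+f(v)(t)\ge0$ for a.e. $t\ge t_0$ and every $v\in C_0(\mathbb{R};\mathbb{R}_+)$ with $v(t)\le\kappa$ for $t\le t_0$. Let, in addition, there exist $\gamma\in AC_{loc}(\mathbb{R};(0,+\infty))$ such that $$\gamma'(t)\le-\ell_1(\gamma)(t)\quad\text{for a.e. }t\in\mathbb{R},\qquad \ell_0(1)(t)\ge\frac{\ell_1(\gamma)(t)}{\gamma(t)}\quad\text{for a.e. }t\le t_0,$$ and $$M_\sigma:=\sup\left\{\int_{\sigma(t)}^t\frac{\ell_1(\gamma)(s)}{\gamma(s)}\,ds:\ t\le t_0\right\}<+\infty.$$ Then, for every $c\in(0,\kappa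 e^{-M_\sigma}]$, there exists a global solution $u$ to $u'(t)=\ell_0(u)(t)-\ell_1(u)(t)+f(u)(t)$, $u(t_0)=c$, satisfying $0\le u(t)\le\kappa$ for $t\le t_0$ and $u(t)>0$ for $t\ge t_0$.
   Context: Notation. $\mathbb{R}_+=[0,+\infty)$. $C_{loc}(\mathbb{R};\mathbb{R})$ is the space of continuous functions $\mathbb{R}\to\mathbb{R}$ with the topology of uniform convergence on every compact interval. $L_{loc}(\mathbb{R};\mathbb{R})$ is the space of locally Lebesgue-integrable functions on $\mathbb{R}$ with the topology of convergence in the mean on every compact interval. For $I,D\subseteq\mathbb{R}$: $C_0(I;D)$ is the set of bounded continuous functions $I\to D$; $AC_{loc}(I;D)$ is the set of functions $I\to D$ absolutely continuous on every compact interval contained in $I$; $L_{loc}(I;\mathbb{R}_+)$ is the set of functions $I\to\mathbb{R}_+$ integrable on every compact interval contained in $I$. $\|v\|=\sup\{|v(t)|:t\in\mathbb{R}\}$. $\operatorname{sgn}$ is the sign function with $\operatorname{sgn}0=0$. $K_{loc}([t_0,+\infty)\times\mathbb{R}_+;\mathbb{R}_+)$ is the set of functions $q:[t_0,+\infty)\times\mathbb{R}_+\to\mathbb{R}_+$ such that $q(\cdot,x)$ is measurable for every $x$, $q(t,\cdot)$ is continuous for a.e. $t$, and for every compact $D\subset\mathbb{R}_+$ the function $\sup\{q(\cdot,x):x\in D\}$ is integrable on every compact subinterval of $[t_0,+\infty)$. Standing assumptions. $\ell_0,\ell_1:C_{loc}(\mathbb{R};\mathbb{R})\to L_{loc}(\mathbb{R};\mathbb{R})$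 are linear continuous operators which are positive (map non-negative functions to non-negative functions). $f:C_{loc}(\mathbb{R};\mathbb{R})\to L_{loc}(\mathbb{R};\mathbb{R})$ is a continuous operator satisfying the local Carathéodory conditions: for every $r>0$ there is $q_r\in L_{loc}(\mathbb{R};\mathbb{R}_+)$ with $|f(v)(t)|\le q_r(t)$ for a.e. $t\in\mathbb{R}$ whenever $\sup_{\mathbb{R}}|v|\le r$. For an operator $T$, $T(1)$ and $T(0)$ are the values of $T$ at constant functions. For $\tau\in\mathbb{R}$, $V_\tau$ is the set of continuous operators $T:C_{loc}(\mathbb{R};\mathbb{R})\to L_{loc}(\mathbb{R};\mathbb{R})$ such that for every $\zeta\le\tau$, $T(u)(t)=T(v)(t)$ for a.e. $t\le\zeta$ whenever $u,v\in C_{loc}(\mathbb{R};\mathbb{R})$ and $u=v$ on $(-\infty,\zeta]$. $V=\bigcap_{\tau\in\mathbb{R}}V_\tau$. $\Sigma$ is the set of continuous $\sigma:\mathbb{R}\to\mathbb{R}$ with $\sigma(t)\le t$ for all $t$. For $\sigma\in\Sigma$, $V_\tau(\sigma)$ is the set of continuous operators $T:C_{loc}(\mathbb{R};\mathbb{R})\to L_{loc}(\mathbb{R};\mathbb{R})$ such that, for a.e. $t\le\tau$, $T(u)(t)=T(v)(t)$ whenever $u,v\in C_{loc}(\mathbb{R};\mathbb{R})$ satisfy $u(s)=v(s)$ for $s\in[\sigma(t),t]$. A global solution is a function $u:\mathbb{R}\to\mathbb{R}$ absolutely continuous on every compact interval and satisfying the equation for a.e. $t\in\mathbb{R}$. 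*)

(* Defs.v *)
From HB Require Import structures.
From mathcomp Require Import all_boot all_order all_algebra.
From mathcomp Require Import all_classical all_reals all_analysis.

Set Implicit Arguments.
Unset Strict Implicit.
Unset Printing Implicit Defensive.

Export Order.TTheory GRing.Theory Num.Def Num.Theory.
Export numFieldNormedType.Exports.

#[global] Open Scope classical_set_scope.
#[global] Open Scope ring_scope.

(* An operator C_loc(R;R) -> L_loc(R;R) is a map T : (R -> R) -> (R -> R);
   only its values at continuous functions matter, and T u is a Borel
   representative of an element of L_loc, a space of classes modulo equality
   almost everywhere. Properties of T are therefore stated for each (pair of)
   argument(s) up to a null set which may depend on the argument(s). *)

Section function_spaces.
Variable R : realType.
Implicit Types (I D : set R) (g h u v : R -> R) (q : R -> R -> R).
Local Notation mu := (@lebesgue_measure R).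

Definition Lloc I h : Prop :=
  forall a b : R, `[a, b] `<=` I -> mu.-integrable `[a, b] (EFin \o h).

(* The sigma-algebra of lebesgue_measure is the Borel one: a function is
   Lebesgue measurable (integrable) when it is almost everywhere equal to a
   Borel measurable (integrable) one. *)
Definition lebesgue_measurable_on I h : Prop :=
  exists2 g, measurable_fun I g & {ae mu, forall t, I t -> h t = g t}.

Definition lebesgue_integrable_on I h : Prop :=
  exists2 g, mu.-integrable I (EFin \o g) & {ae mu, forall t, I t -> h t = g t}.

Definition C0 D v : Prop :=
  [/\ continuous v, bounded_fun v & forall t, D (v t)].

Definition supnorm v : R := sup (range (fun t => `|v t|)).

Definition abs_continuous_on (a b : R) g : Prop :=
  forall e : R, 0 < e -> exists2 d : R, 0 < d &
    forall (n : nat) (x y : 'I_n -> R),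
      (forall i, [/\ a <= x i, x i <= y i & y i <= b]) ->
      trivIset [set: 'I_n] (fun i => `]x i, y i[%classic) ->
      \sum_(i < n) (y i - x i) < d ->
      \sum_(i < n) `|g (y i) - g (x i)| < e.

Definition ACloc I D g : Prop :=
  (forall t, I t -> D (g t)) /\
  (forall a b : R, `[a, b] `<=` I -> abs_continuous_on a b g).

(* K_loc([t0, +oo[ x R_+; R_+). The real-valued sup is the genuine supremum for
   almost every t >= t0, since q t is then bounded on the compact set D; for
   D empty it is 0. *)
Definition Kloc (t0 : R) q : Prop :=
  [/\ forall t x : R, t0 <= t -> 0 <= x -> 0 <= q t x,
      forall x : R, 0 <= x -> lebesgue_measurable_on `[t0, +oo[ (q ^~ x),
      {ae mu, forall t, t0 <= t -> {within `[0, +oo[, continuous (q t)}} &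
      forall D, D `<=` `[0, +oo[ -> compact D ->
        forall a b : R, `[a, b] `<=` `[t0, +oo[ ->
          lebesgue_integrable_on `[a, b] (fun t => sup (q t @` D))].

End function_spaces.

Section operators.
Variable R : realType.
Implicit Types (T : (R -> R) -> R -> R) (u v sigma : R -> R) (tau : R).
Local Notation mu := (@lebesgue_measure R).

(* Continuity from the topology of uniform convergence on compact sets to the
   topology defined by the seminorms h |-> \int_[a, b] |h|. *)
Definition continuous_operator T : Prop :=
  (forall u, continuous u -> Lloc [set: R] (T u)) /\
  (forall u, continuous u -> forall a b : R,
     (fun v => \int[mu]_(t in `[a, b]) (`|T v t - T u t|)%:E)%E
       @ within [set v : R -> R | continuous v]
           (nbhs (u : {family compact, R -> R})) --> 0%E).

Definition linear_operator T : Prop :=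
  forall (a : R) u v, continuous u -> continuous v ->
    {ae mu, forall t, T (fun s => a * u s + v s) t = a * T u t + T v t}.

Definition positive_operator T : Prop :=
  forall u, continuous u -> (forall s : R, 0 <= u s) ->
    {ae mu, forall t, 0 <= T u t}.

Definition local_Caratheodory T : Prop :=
  forall r : R, 0 < r -> exists qr : R -> R,
    [/\ Lloc [set: R] qr, forall t, 0 <= qr t &
        forall v, continuous v -> (forall s : R, `|v s| <= r) ->
          {ae mu, forall t, `|T v t| <= qr t}].

(* The classes V_tau, V, Sigma and V_tau(sigma) are Volterra_upto tau, Volterra,
   delay and Volterra_delay_upto tau sigma. *)
Definition Volterra_upto tau T : Prop :=
  continuous_operator T /\
  forall zeta, zeta <= tau ->
    forall u v, continuous u -> continuous v ->
      (forall s : R, s <= zeta -> u s = v s) ->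
      {ae mu, forall t, t <= zeta -> T u t = T v t}.

Definition Volterra T : Prop := forall tau, Volterra_upto tau T.

Definition delay sigma : Prop := continuous sigma /\ forall t, sigma t <= t.

Definition Volterra_delay_upto tau sigma T : Prop :=
  continuous_operator T /\
  forall u v, continuous u -> continuous v ->
    {ae mu, forall t, t <= tau ->
       (forall s : R, sigma t <= s <= t -> u s = v s) -> T u t = T v t}.

Definition M_sigma (t0 : R) sigma (ell1 : (R -> R) -> R -> R) (gamma : R -> R)
    : \bar R :=
  ereal_sup [set (\int[mu]_(s in `[sigma t, t]) (ell1 gamma s / gamma s)%:E)%E
            | t in `]-oo, t0]].

Definition global_solution (ell0 ell1 f : (R -> R) -> R -> R) u : Prop :=
  ACloc [set: R] [set: R] u /\
  {ae mu, forall t : R, is_derive t 1 u (ell0 u t - ell1 u t + f u t)}.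

End operators.

(* Main.v *)
(* The equation is first solved on [a, b], a < t0 < b, for functions that are
   constant on ]-oo, a], with u replaced on the right-hand side by its truncation
   v to [0, T], where T = kappa before t0 and, after t0, T solves a differential
   inequality T' >= ell0(1) T + q(., rho) with T <= rho on [t0, b]; such a rho
   exists because q is sublinear. Delaying the integrated equation by d > 0 gives
   a problem solvable step by step, whose solution depends continuously on the
   initial value x in [0, kappa]; the intermediate value theorem yields either
   u t0 = c, or x = kappa and u t0 <= c, and d tends to 0 by Ascoli's theorem.
   Since gamma' <= - ell1 gamma, a maximum principle shows that u / gamma is
   nondecreasing; hence u is positive and ell1 v <= (v / gamma) ell1 gamma.
   Together with ell0 in V_t0(sigma) and ell0(1) >= ell1(gamma) / gamma, this gives
   u s <= e^M u t0 for s <= t0. Hence u t0 = c and u <= kappa before t0, while (ii)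
   gives u <= T after t0, so that the truncation is inactive. The same comparison
   bounds u on [t0, b] independently of a and of larger b, and a compactness
   argument lets a tend to -oo and b to +oo.
   The hypothesis on gamma' holds only almost everywhere, so it is used through
   the representation of gamma as an integral, obtained from the positive
   variation and the Radon-Nikodym theorem. *)

From HB Require Import structures.
Require Import Defs.
From mathcomp Require Import all_boot all_order all_algebra.
From mathcomp Require Import all_classical all_reals all_analysis.
From mathcomp Require Import measurable_realfun ring lra.

Import Order.TTheory GRing.Theory Num.Def Num.Theory.
Import numFieldNormedType.Exports.

Set Implicit Arguments.
Unset Strict Implicit.
Unset Printing Implicit Defensive.

Local Open Scope classical_set_scope.
Local Open Scope ring_scope.

(** The condition is imposed at t0 while the operators look back, so the problem is integrated
    forwards from a with an unknown constant past x, and x has to be tuned. Solutions need not be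
    unique, so u t0 is not a function of x. With the delay d the solution is a finite iterate,
    single-valued and continuous in x, and the intermediate value theorem applies before d tends to
    0. The bound c <= kappa e^-M settles the second outcome of the shooting: x = kappa forces kappa
    e^-M <= u t0, so that u t0 = c there too. The differential inequalities hold only almost
    everywhere and involve the whole past of a function. The comparisons are therefore made on
    increments of integrals: an error that is a product of increments of a continuous function and
    of a monotone one disappears when a partition is refined. *)

(** * Integrals over compact intervals and almost everywhere inequalities *)

Section interval_integral.
Variable R : realType.
Implicit Types (h g u v : R -> R) (a b s t : R).
Local Notation mu := (@lebesgue_measure R).

Lemma aeS (P Q : R -> Prop) : {ae mu, forall x, P x} ->
  (forall x, P x -> Q x) -> {ae mu, forall x, Q x}.
Proof. by move=> HP PQ; apply: (@filterS _ _ (ae_filter_ringOfSetsType mu) _ _ _ HP). Qed.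

Lemma aeI (P Q : R -> Prop) : {ae mu, forall x, P x} ->
  {ae mu, forall x, Q x} -> {ae mu, forall x, P x /\ Q x}.
Proof. exact: (@filterI _ _ (ae_filter_ringOfSetsType mu)). Qed.

Lemma aeW (P : R -> Prop) : (forall x, P x) -> {ae mu, forall x, P x}.
Proof. exact: (@filterE _ _ (ae_filter_ringOfSetsType mu)). Qed.

(** The integral is not oriented: it vanishes for t <= s. Hence [intg h a] is constant on ]-oo, a],
    which is how constant pasts arise below. *)
Definition intg h s t : R := \int[mu]_(x in `[s, t]) h x.

Lemma LlocT h : Lloc [set: R] h <-> forall a b, mu.-integrable `[a, b] (EFin \o h).
Proof. by split => [H a b|H a b _]; [exact: H|exact: H]. Qed.

Lemma Lloc_itv h a b : Lloc [set: R] h -> mu.-integrable `[a, b] (EFin \o h).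
Proof. by move=> /LlocT. Qed.

Lemma LlocD h g : Lloc [set: R] h -> Lloc [set: R] g -> Lloc [set: R] (h \+ g).
Proof.
move=> /LlocT H /LlocT G; apply/LlocT => a b.
by apply: eq_integrable (integrableD _ (H a b) (G a b)) => //= x _.
Qed.

Lemma LlocZ (k : R) h : Lloc [set: R] h -> Lloc [set: R] (fun x => k * h x).
Proof.
move=> /LlocT H; apply/LlocT => a b.
by apply: eq_integrable (integrableZl _ k (H a b)) => //= x _.
Qed.

Lemma LlocN h : Lloc [set: R] h -> Lloc [set: R] (\- h).
Proof.
move=> /(LlocZ (-1)) H; congr (Lloc _ _): H.
by apply/funext => x; rewrite mulN1r.
Qed.

Lemma LlocB h g : Lloc [set: R] h -> Lloc [set: R] g -> Lloc [set: R] (h \- g).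
Proof. by move=> H /LlocN; exact: LlocD. Qed.

Lemma Lloc_norm h : Lloc [set: R] h -> Lloc [set: R] (fun x => `|h x|).
Proof.
move=> /LlocT H; apply/LlocT => a b.
by have := integrable_abse (H a b); apply: eq_integrable.
Qed.

Lemma Lloc_continuousM h g :
  continuous g -> Lloc [set: R] h -> Lloc [set: R] (fun x => g x * h x).
Proof.
move=> cg /LlocT H; apply/LlocT => a b.
have mg : measurable_fun `[a, b] g.
  by apply: measurable_funTS; exact: continuous_measurable_fun.
have bg : [bounded g x | x in `[a, b]%classic].
  have : compact (g @` `[a, b]%classic).
    by apply: continuous_compact (@segment_compact _ a b); exact: continuous_subspaceT.
  move=> /compact_bounded [M [Mr HM]]; exists M; split => // x Mx y yab.
  by apply: HM Mx _ _; exists y.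
by apply: eq_integrable (@integrableMr _ _ R mu _ _ g _ mg bg (H a b)).
Qed.

Lemma Lloc_continuous g : continuous g -> Lloc [set: R] g.
Proof.
move=> cg; apply/LlocT => a b; apply: continuous_compact_integrable.
  exact: segment_compact.
exact: continuous_subspaceT.
Qed.

Lemma intg_cat h s r t : Lloc [set: R] h -> s <= r -> r <= t ->
  intg h s t = intg h s r + intg h r t.
Proof.
move=> H sr rt; have sB := Lloc_itv s t H.
rewrite /intg; have <- := @Rintegral_itv_obnd_cbnd R r (BRight t) h; last first.
  by apply: integrableS (Lloc_itv r t H) => //; apply: subset_itvr; rewrite bnd_simp.
by rewrite -(Rintegral_itvB sB) ?bnd_simp// addrC subrK.
Qed.

Lemma intg_eq0 h s t : t <= s -> intg h s t = 0.
Proof.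
rewrite le_eqVlt => /predU1P[->|ts]; first by rewrite /intg set_itv1 Rintegral_set1.
by rewrite /intg set_itv_ge ?Rintegral_set0// bnd_simp -ltNge.
Qed.

Lemma intg_ge0 h s t : Lloc [set: R] h ->
  {ae mu, forall x, s <= x <= t -> 0 <= h x} -> 0 <= intg h s t.
Proof.
move=> H h0; have iH := Lloc_itv s t H.
(* The sign is known only almost everywhere, while the absolute value is nonnegative at every
   point. *)
have -> : intg h s t = intg (fun x => `|h x|) s t.
  congr fine; apply: ae_eq_integral => //.
  - exact: measurable_int iH.
  - exact: measurable_int (Lloc_itv s t (Lloc_norm H)).
  - have E : {ae mu, forall x, `[s, t]%classic x -> (h x)%:E = `|h x|%:E}.
      by apply: (aeS h0) => x + /=; rewrite in_itv/= => + xst => /(_ xst) /ger0_norm ->.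
    exact: E.
by apply: Rintegral_ge0 => x _.
Qed.

Lemma intgD h g s t : Lloc [set: R] h -> Lloc [set: R] g ->
  intg (h \+ g) s t = intg h s t + intg g s t.
Proof. by move=> H G; rewrite /intg RintegralD//; exact: Lloc_itv. Qed.

Lemma intgB h g s t : Lloc [set: R] h -> Lloc [set: R] g ->
  intg (h \- g) s t = intg h s t - intg g s t.
Proof. by move=> H G; rewrite /intg RintegralB//; exact: Lloc_itv. Qed.

Lemma intgZ (k : R) h s t : Lloc [set: R] h ->
  intg (fun x => k * h x) s t = k * intg h s t.
Proof. by move=> H; rewrite /intg RintegralZl//; exact: Lloc_itv. Qed.

Lemma intgN h s t : Lloc [set: R] h -> intg (\- h) s t = - intg h s t.
Proof.
move=> H; rewrite -mulN1r -intgZ//; congr (intg _ s t).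
by apply/funext => x; rewrite mulN1r.
Qed.

Lemma le_intg h g s t : Lloc [set: R] h -> Lloc [set: R] g ->
  {ae mu, forall x, s <= x <= t -> h x <= g x} -> intg h s t <= intg g s t.
Proof.
move=> H G hg; rewrite -subr_ge0 -intgB//; apply: intg_ge0; first exact: LlocB.
by apply: (aeS hg) => x /= + xst => /(_ xst); rewrite subr_ge0.
Qed.

Lemma eq_intg h g s t : Lloc [set: R] h -> Lloc [set: R] g ->
  {ae mu, forall x, s <= x <= t -> h x = g x} -> intg h s t = intg g s t.
Proof.
move=> H G hg; apply/eqP; rewrite eq_le !le_intg//.
  by apply: (aeS hg) => x /= + xst => /(_ xst) ->.
by apply: (aeS hg) => x /= + xst => /(_ xst) ->.
Qed.

Lemma norm_intg h s t : Lloc [set: R] h ->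
  `|intg h s t| <= intg (fun x => `|h x|) s t.
Proof. by move=> H; apply: le_normr_Rintegral => //; exact: Lloc_itv. Qed.

Lemma le_intg_itv h s t s' t' : Lloc [set: R] h ->
  {ae mu, forall x, s' <= x <= t' -> 0 <= h x} ->
  s' <= s -> s <= t -> t <= t' -> intg h s t <= intg h s' t'.
Proof.
move=> H h0 ss st tt.
rewrite (intg_cat H ss (le_trans st tt)) (intg_cat H st tt).
have A : 0 <= intg h s' s.
  apply: intg_ge0 => //; apply: (aeS h0) => x /= + /andP[sx xs]; apply.
  by rewrite sx (le_trans xs)// (le_trans st).
have B : 0 <= intg h t t'.
  apply: intg_ge0 => //; apply: (aeS h0) => x /= + /andP[sx xs]; apply.
  by rewrite xs andbT (le_trans ss)// (le_trans st).
lra.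
Qed.

Lemma continuous_intg h a : Lloc [set: R] h -> continuous (intg h a).
Proof.
(* Starting at a - 1 and clamping z at a puts every evaluation point inside an interval, where the
   continuity of the parameterized integral is two-sided. *)
move=> H x; have -> : intg h a = (fun z => intg h (a - 1) (Num.max z a) - intg h (a - 1) a).
  apply/funext => z; have [za|az] := leP z a; first by rewrite subrr intg_eq0.
  by rewrite (@intg_cat h (a - 1) a z) ?(ltW az) ?gerBl// addrC addKr.
apply: cvgB; last exact: cvg_cst.
apply: (@continuous_comp _ _ _ (fun z => Num.max z a) (intg h (a - 1))).
  by apply: continuous_max; [exact: cvg_id|exact: cvg_cst].
set y := Num.max x a; have ay : a - 1 < y by rewrite (@lt_le_trans _ _ a) ?gtrBl// le_max lexx orbT.
have yb : y < y + 1 by rewrite ltrDl.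
have ab := ltW (lt_trans ay yb).
have := parameterized_integral_continuous ab (Lloc_itv (a - 1) (y + 1) H).
move=> /(continuous_within_itvP _ (lt_trans ay yb))[+ _ _].
by apply; rewrite in_itv/= ay.
Qed.

End interval_integral.

(** * Gronwall-type inequalities for increments *)

Section quadratic_increments.
Variable R : realType.
Implicit Types (f y : R -> R) (a b s t : R).

Lemma unif_continuous_itv f a b : continuous f ->
  forall e : R, 0 < e -> exists2 d : R, 0 < d & forall s t, a <= s <= b -> a <= t <= b ->
    `|s - t| < d -> `|f s - f t| < e.
Proof.
move=> cf e e0.
have : \forall d \near (0 : R)^'+, `[a, b]%classic `<=`
    [set s | forall t, `|s - t| < d -> `|f s - f t| < e].
  apply: (proj1 (compact_near_coveringP _) (@segment_compact _ a b)) => s _.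
  have /(@cvgrPdist_lt _ _) /(_ (e / 2)) := cf s.
  have e2 : 0 < e / 2 by rewrite divr_gt0.
  move=> /(_ e2) /nbhs_ballP [r /= r0 Hr].
  exists (ball s (r / 2), [set d : R | d < r / 2]%classic) => /=.
    split; first exact/nbhsx_ballx/divr_gt0.
    exact: nbhs_right_lt (divr_gt0 _ _).
  move=> [s' d] /= [s's dr] t s't.
  have A1 : `|f s - f s'| < e / 2.
    by apply: Hr; rewrite /ball/= (lt_trans s's)// ltr_pdivrMr// ltr_pMr// ltr1n.
  have A2 : `|f s - f t| < e / 2.
    apply: Hr; rewrite /ball/= -(subrK s' s) -addrA (le_lt_trans (ler_normD _ _))//.
    by rewrite [ltRHS]splitr ltrD// (lt_trans s't).
  rewrite -(subrK (f s) (f s')) -addrA (le_lt_trans (ler_normD _ _))//.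
  by rewrite [ltRHS]splitr ltrD// distrC.
move=> /filterI /(_ (nbhs_right_gt 0)) /(@filter_ex _ _ _)[d /= [Hd d0]].
by exists d => // s t sab _; apply: Hd; rewrite /= in_itv.
Qed.

(* Partition [a, b] into n equal pieces: the increments of B are at most e on each. *)
Lemma nonincreasing_quadratic (D B L : R -> R) a b : a <= b -> continuous B ->
  (forall s t, a <= s -> s <= t -> t <= b -> L s <= L t) ->
  (forall s t, a <= s -> s <= t -> t <= b ->
     D t - D s <= `|B t - B s| * (L t - L s)) ->
  D b <= D a.
Proof.
move=> ab cB ndL HD; apply/ler_addgt0Pl => e e0.
have L0 : 0 <= L b - L a by rewrite subr_ge0 ndL.
(* [D] will grow by at most [k * (L b - L a)], which is below e; the added 1 keeps the denominator
   positive. *)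
pose k := e / (L b - L a + 1).
have k0 : 0 < k by rewrite divr_gt0// ltr_wpDl.
have [d d0 Hd] := unif_continuous_itv a b cB k0.
have [n Hn] : exists n : nat, (b - a) < n.+1%:R * d.
  exists (Num.bound ((b - a) / d)); rewrite -ltr_pdivrMr//.
  have := archi_boundP (divr_ge0 (_ : 0 <= b - a) (ltW d0)).
  by rewrite subr_ge0 => /(_ ab) /lt_trans; apply; rewrite ltr_nat.
pose x i := a + (b - a) * (i%:R / n.+1%:R).
have xS i : x i.+1 - x i = (b - a) / n.+1%:R.
  by rewrite /x -natr1; field; rewrite addrC natr1 pnatr_eq0.
have xle i : x i <= x i.+1 by rewrite -subr_ge0 xS divr_ge0// subr_ge0.
have x0 : x 0 = a by rewrite /x mul0r mulr0 addr0.
have xn : x n.+1 = b by rewrite /x divff ?pnatr_eq0// mulr1 addrC subrK.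
have xa i : a <= x i by elim: i => [|i IH]; rewrite ?x0// (le_trans IH).
have xb i : (i <= n.+1)%N -> x i <= b.
  move=> ni; rewrite /x -lerBrDl ler_piMr ?subr_ge0//.
  by rewrite ler_pdivrMr ?ltr0n// mul1r ler_nat.
have main i : (i <= n.+1)%N -> D (x i) - D a <= k * (L (x i) - L a).
  elim: i => [|i IH] ni; first by rewrite x0 !subrr mulr0.
  have {}IH := IH (ltnW ni).
  have := HD _ _ (xa i) (xle i) (xb _ ni).
  have Bk : `|B (x i.+1) - B (x i)| <= k.
    apply/ltW/Hd; rewrite ?xa ?xb// ?(ltnW ni)//.
    by rewrite xS ger0_norm ?divr_ge0 ?subr_ge0// ltr_pdivrMr ?ltr0n// mulrC.
  have Li : 0 <= L (x i.+1) - L (x i) by rewrite subr_ge0 ndL// xb.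
  have := ler_wpM2r Li Bk. lra.
have := main n.+1 (leqnn _); rewrite xn => H.
rewrite -lerBlDr (le_trans H)// /k mulrAC ler_pdivrMr ?ltr_wpDl//.
by rewrite ler_pM2l// lerDl.
Qed.

(* The function - y e^P satisfies the hypothesis of nonincreasing_quadratic. *)
Lemma backward_gronwall y (P : R -> R) a b C : a <= b -> continuous P ->
  (forall s t, a <= s -> s <= t -> t <= b -> P s <= P t) ->
  (forall t, a <= t <= b -> 0 <= y t <= C) ->
  (forall s t c, a <= s -> s <= t -> t <= b ->
     (forall r, s <= r <= t -> y r <= c) -> y s <= y t + c * (P t - P s)) ->
  y a * expR (P a) <= y b * expR (P b).
Proof.
move=> ab cP ndP yC H.
have C0 : 0 <= C.
  by have := yC a; rewrite lexx ab => /(_ isT) /andP[/le_trans h /h].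
rewrite -lerN2.
(* The increment of - y e^P over [s, t] will be at most e^(P s) C (P t - P s)^2, and e^(P s) <= e^(P
   b). *)
pose B t := C * expR (P b) * P t.
apply: (@nonincreasing_quadratic (fun t => - (y t * expR (P t))) B P) => //.
  by move=> t; apply: cvgM; [exact: cvg_cst|exact: cP].
move=> s t as_ st tb.
have sb := le_trans st tb; have at_ := le_trans as_ st.
have yt : 0 <= y t <= C by apply: yC; rewrite at_.
have P0 : 0 <= P t - P s by rewrite subr_ge0 ndP.
(* Inserting the crude bound C in [H] gives this bound on [s, t]; inserting the latter in turn
   leaves only a second-order error. *)
have H1 r : s <= r <= t -> y r <= y t + C * (P t - P s).
  move=> /andP[sr rt]; have := H r t C (le_trans as_ sr) rt tb.
  have R1 : forall r0, r <= r0 <= t -> y r0 <= C.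
    move=> r0 /andP[rr rt0]; have := yC r0.
    by rewrite (le_trans as_ (le_trans sr rr)) (le_trans rt0 tb) => /(_ isT) /andP[].
  move=> /(_ R1) /le_trans; apply; rewrite lerD2l ler_wpM2l// lerB// ndP//.
  exact: (le_trans rt tb).
have H2 := H s t _ as_ st tb H1.
have H3 : 1 + (P t - P s) <= expR (P t - P s) by exact: expR_ge1Dx.
have -> : expR (P t) = expR (P s) * expR (P t - P s) by rewrite -expRD addrC subrK.
rewrite /B -mulrBr normrM (ger0_norm P0) ger0_norm ?mulr_ge0 ?expR_ge0//.
have E1 : expR (P s) <= expR (P b) by rewrite ler_expR ndP.
have E2 := expR_ge0 (P s).
set E := expR (P t - P s) in H3 *; set w := P t - P s in H3 H2 P0 *.
have S1 : y s - y t * E <= C * w * w.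
  have /andP[yt0 _] := yt.
  have := ler_wpM2l yt0 H3. lra.
have S2 := ler_wpM2l E2 S1.
have S3 : expR (P s) * (C * w * w) <= expR (P b) * (C * w * w).
  by rewrite ler_wpM2r// !mulr_ge0.
lra.
Qed.

End quadratic_increments.

(** * Absolutely continuous functions are integrals *)

Section interval_families.
Variable R : realType.
Implicit Types (F D : R -> R) (a b c d s t : R).

(** Intervals of length 0 are allowed, so that a family can be cut at a point by [Num.min] and
    [Num.max] without changing its index type. *)
Definition itv_family a b n (x y : 'I_n -> R) : Prop :=
  (forall i, [/\ a <= x i, x i <= y i & y i <= b]) /\
  trivIset [set: 'I_n] (fun i => `]x i, y i[%classic).

Definition increments F n (x y : 'I_n -> R) : R := \sum_(i < n) (F (y i) - F (x i)).

Lemma itv_family0 a b : itv_family a b (fun _ : 'I_0 => 0) (fun=> 0).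
Proof. by split => [[]//|[]//]. Qed.

Lemma increments0 F (x y : 'I_0 -> R) : increments F x y = 0.
Proof. by rewrite /increments big_ord0. Qed.

Lemma itv_family_widen a b c d n (x y : 'I_n -> R) : c <= a -> b <= d ->
  itv_family a b x y -> itv_family c d x y.
Proof.
move=> ca bd [H T]; split => // i; have [ax xy yb] := H i.
by split => //; [exact: le_trans ax|exact: le_trans bd].
Qed.

Lemma itv_family_sub a b c d n (x y x' y' : 'I_n -> R) :
  itv_family a b x y ->
  (forall i, [/\ c <= x' i, x' i <= y' i & y' i <= d]) ->
  (forall i, `]x' i, y' i[%classic `<=` `]x i, y i[%classic) ->
  itv_family c d x' y'.
Proof.
move=> [_ T] H sub; split => // i j _ _ [z [zi zj]]; apply: T => //.
by exists z; split; exact: sub.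
Qed.

Lemma itv_family_min a b c n (x y : 'I_n -> R) : a <= c ->
  itv_family a b x y -> itv_family a c (fun i => Num.min (x i) c) (fun i => Num.min (y i) c).
Proof.
move=> ac /[dup] -[H _] /itv_family_sub; apply => i; have [ax xy yb] := H i.
- split; first by rewrite le_min ax ac.
  + by rewrite le_min !ge_min xy lexx orbT.
  + by rewrite ge_min lexx orbT.
- move=> z /=; rewrite !in_itv/= lt_min => /andP[xz /andP[-> zc]]; rewrite andbT.
  by move: xz; rewrite gt_min => /orP[//|/(lt_trans zc)]; rewrite ltxx.
Qed.

Lemma itv_family_max a b c n (x y : 'I_n -> R) : c <= b ->
  itv_family a b x y -> itv_family c b (fun i => Num.max (x i) c) (fun i => Num.max (y i) c).
Proof.
move=> cb /[dup] -[H _] /itv_family_sub; apply => i; have [ax xy yb] := H i.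
- split; first by rewrite le_max lexx orbT.
  + by rewrite ge_max !le_max xy lexx orbT.
  + by rewrite ge_max yb cb.
- move=> z /=; rewrite !in_itv/= gt_max => /andP[/andP[-> cz]] /=.
  by rewrite lt_max => /orP[//|/(lt_trans cz)]; rewrite ltxx.
Qed.

Lemma increments_min_max F c n (x y : 'I_n -> R) :
  increments F x y =
  increments F (fun i => Num.min (x i) c) (fun i => Num.min (y i) c) +
  increments F (fun i => Num.max (x i) c) (fun i => Num.max (y i) c).
Proof.
rewrite /increments -big_split/=; apply: eq_bigr => i _.
by case: (leP (x i) c) => xc; case: (leP (y i) c) => yc; lra.
Qed.

Lemma itv_family_cat F a b c n m (x y : 'I_n -> R) (x' y' : 'I_m -> R) :
  a <= b -> b <= c -> itv_family a b x y -> itv_family b c x' y' ->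
  exists k (z w : 'I_k -> R), itv_family a c z w /\
    increments F z w = increments F x y + increments F x' y'.
Proof.
move=> ab bc [H T] [H' T'].
have sL (j : 'I_n) : fintype.split (lshift m j) = inl j := unsplitK (inl j).
have sR (j : 'I_m) : fintype.split (rshift n j) = inr j := unsplitK (inr j).
pose z i := match fintype.split i with inl j => x j | inr j => x' j end.
pose w i := match fintype.split i with inl j => y j | inr j => y' j end.
exists (n + m)%N, z, w; split; last first.
  rewrite /increments big_split_ord/=; congr (_ + _); apply: eq_bigr => i _; rewrite /z /w.
    by rewrite sL.
  by rewrite sR.
split.
  move=> i; rewrite /z /w; case: (fintype.split i) => j.
    by have [? ? yb] := H j; split => //; exact: le_trans bc.
  by have [bx ? ?] := H' j; split => //; exact: le_trans bx.
move=> i j _ _ [r]; rewrite /z /w.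
rewrite -[i]splitK -[j]splitK; case: (fintype.split i) => i'; case: (fintype.split j) => j' [/=]; rewrite ?sL ?sR.
- by move=> A B; congr lshift; apply: T => //; exists r.
- rewrite !in_itv/= => /andP[_ ry] /andP[xr _].
  have [_ _ yb] := H i'; have [bx _ _] := H' j'.
  by have := lt_le_trans ry yb; rewrite ltNge (le_trans bx (ltW xr)).
- rewrite !in_itv/= => /andP[xr _] /andP[_ ry].
  have [_ _ yb] := H j'; have [bx _ _] := H' i'.
  by have := lt_le_trans ry yb; rewrite ltNge (le_trans bx (ltW xr)).
- by move=> A B; congr rshift; apply: T' => //; exists r.
Qed.

(* Induction on the intervals of positive length: remove the rightmost one. *)
Lemma increments_nondecreasing D a b n (x y : 'I_n -> R) : a <= b ->
  (forall s t, a <= s -> s <= t -> t <= b -> D s <= D t) ->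
  itv_family a b x y -> increments D x y <= D b - D a.
Proof.
move=> ab ndD [H T].
have main (k : nat) : forall (A : {set 'I_n}) (e : R), #|A| = k ->
    (forall i, i \in A -> x i < y i) -> (forall i, i \in A -> y i <= e) ->
    a <= e -> e <= b -> \sum_(i in A) (D (y i) - D (x i)) <= D e - D a.
  elim: k => [|k IH] A e cA Axy Ae ae eb.
    have -> : A = finset.set0 by apply/eqP; rewrite -cards_eq0 cA.
    by rewrite big_set0 subr_ge0 ndD.
  have [i0 i0A] : exists i, i \in A by apply/set0Pn; rewrite -cards_eq0 cA.
  have [i iA imax] := @arg_maxP _ _ _ i0 (mem A) x i0A.
  have {}iA : i \in A by exact: iA.
  have {}imax j : j \in A -> x j <= x i by exact: imax.
  have [axi xyi yib] := H i.
  rewrite (big_setD1 i)//=.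
  have := IH (A :\ i) (x i); rewrite (cardsD1 i A) iA in cA; case: cA => cA.
  move=> /(_ cA) IHi.
  have {IHi} : \sum_(i1 in A :\ i) (D (y i1) - D (x i1)) <= D (x i) - D a.
    apply: IHi => //; last exact: le_trans xyi yib.
      by move=> j; rewrite !inE => /andP[_ /Axy].
    move=> j; rewrite !inE => /andP[ji jA]; rewrite leNgt; apply/negP => xiyj.
    have xji : x j <= x i by exact: imax.
    have xyi' := Axy i iA.
    have : x i < Num.min (y i) (y j) by rewrite lt_min xyi' xiyj.
    move=> /midf_lt[m1 m2]; move: m2; rewrite lt_min => /andP[m2 m3].
    move/eqP : ji; apply; apply: T => //.
    exists ((x i + Num.min (y i) (y j)) / 2); split; rewrite /= in_itv/=.
      by rewrite m3 (le_lt_trans xji).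
    by rewrite m1 m2.
  have : D (y i) <= D e by apply: ndD => //; [exact: le_trans xyi|exact: Ae].
  lra.
pose A := [set i | x i < y i]%SET.
rewrite /increments (bigID (fun i => i \in A))/= [X in _ + X]big1 ?addr0.
  apply: (main _ A b erefl) => // i; rewrite inE//.
  by have [_ _] := H i.
move=> i; rewrite inE -leNgt => yx; have [_ xy _] := H i.
by have -> : y i = x i; [apply/eqP; rewrite eq_le yx xy|rewrite subrr].
Qed.

Lemma itv_family_length a b n (x y : 'I_n -> R) : a <= b ->
  itv_family a b x y -> \sum_(i < n) (y i - x i) <= b - a.
Proof. by move=> ab /(@increments_nondecreasing id _ _ _ _ _ ab); apply. Qed.

End interval_families.

(** * Positive variation of absolutely continuous functions *)

Section positive_variation.
Variable R : realType.
Implicit Types (F G : R -> R) (a b c d s t : R).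

Lemma abs_continuous_increments F a b (e : R) : abs_continuous_on a b F -> 0 < e ->
  exists2 d : R, 0 < d & forall n (x y : 'I_n -> R), itv_family a b x y ->
    \sum_(i < n) (y i - x i) < d ->
    increments F x y < e /\ - increments F x y < e.
Proof.
move=> /[apply] -[d d0 Hd]; exists d => // n x y [H T] Hl; have := Hd n x y H T Hl.
have := ler_norm_sum (index_enum 'I_n) (fun i => F (y i) - F (x i)) predT.
rewrite -/(increments F x y) => /le_lt_trans h /h.
by rewrite ltr_norml => /andP[A B]; split => //; rewrite ltrNl.
Qed.

Lemma abs_continuous_onB F G a b : abs_continuous_on a b F ->
  abs_continuous_on a b G -> abs_continuous_on a b (F \- G).
Proof.
move=> HF HG e e0; have e2 : 0 < e / 2 by rewrite divr_gt0.
have [d d0 Hd] := HF _ e2; have [d' d'0 Hd'] := HG _ e2.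
exists (Num.min d d'); first by rewrite lt_min d0.
move=> n x y H T; rewrite lt_min => /andP[/(Hd n x y H T) A /(Hd' n x y H T) B].
rewrite [e]splitr (le_lt_trans _ (ltrD A B))// -big_split/= ler_sum// => i _.
by apply: le_trans (ler_normB _ _); rewrite le_eqVlt; apply/orP; left; apply/eqP; congr Num.norm; ring.
Qed.

(** A family inside a piece of length d / 2 has total length below d, hence increments below 1.
    Cutting a family at the points [z j] bounds its increments by the number of pieces. *)
Lemma abs_continuous_bounded F a b : a <= b -> abs_continuous_on a b F ->
  exists K : R, forall n (x y : 'I_n -> R), itv_family a b x y -> increments F x y <= K.
Proof.
move=> ab /abs_continuous_increments /(_ ltr01)[d d0 Hd].
pose z (j : nat) := Num.min (a + j%:R * (d / 2)) b.
have d20 : 0 < d / 2 by rewrite divr_gt0.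
have az j : a <= z j by rewrite le_min ab lerDl mulr_ge0// ltW.
have zb j : z j <= b by rewrite ge_min lexx orbT.
have main j : forall n (x y : 'I_n -> R), itv_family a (z j) x y -> increments F x y <= j%:R.
  elim: j => [|j IH] n x y Hf.
    rewrite /increments big1// => i _; have [[A B C]] := proj1 Hf i.
    have : y i <= x i by rewrite (le_trans C)// (le_trans _ A)// ge_min mul0r addr0 lexx.
    by move=> yx; have -> : y i = x i; [apply/eqP; rewrite eq_le yx|rewrite subrr].
  have zz : z j <= z j.+1.
    rewrite le_min zb andbT /z ge_min; apply/orP; left.
    by rewrite lerD2l ler_wpM2r ?(ltW d20)// ler_nat.
  rewrite (increments_min_max F (z j)) -natr1 lerD//.
    by apply: IH; exact: itv_family_min Hf.
  have Hm := itv_family_max zz Hf.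
  have [] := Hd _ _ _ (itv_family_widen (az j) (zb j.+1) Hm); last by move=> /ltW.
  rewrite (le_lt_trans (itv_family_length zz Hm))//.
  rewrite (@le_lt_trans _ _ (d / 2)) ?ltr_pdivrMr// ?ltr_pMr ?ltr1n//.
  rewrite lerBlDr {1}/z ge_min; apply/orP.
  have [h|h] := leP (a + j%:R * (d / 2)) b; [left|right].
    by rewrite /z min_l// -natr1; lra.
  by rewrite /z min_r ?(ltW h)// lerDr ltW.
have [N HN] : exists N : nat, b <= a + N%:R * (d / 2).
  exists (Num.bound ((b - a) / (d / 2))).
  rewrite -lerBlDl -ler_pdivrMr// ltW//.
  by apply: archi_boundP; rewrite divr_ge0 ?(ltW d20)// subr_ge0.
exists N%:R => n x y Hf; apply: main; have -> // : z N = b.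
by rewrite /z min_r.
Qed.

(* Continuity moduli of F turn into moduli of its positive variation: a family
   S almost attaining the supremum on [a, b] almost attains it on all subintervals. *)
Lemma abs_continuous_split F a b : a <= b -> abs_continuous_on a b F ->
  exists P : R -> R,
   [/\ (forall s t, a <= s -> s <= t -> t <= b -> P s <= P t),
       (forall s t, a <= s -> s <= t -> t <= b -> P s - F s <= P t - F t) &
       abs_continuous_on a b P].
Proof.
move=> ab acF; have [K HK] := abs_continuous_bounded ab acF.
(* The sums are signed, so their supremum [P] is the positive variation; the empty family makes it
   nonnegative. *)
pose E t := [set v | exists n (x y : 'I_n -> R), itv_family a t x y /\ v = increments F x y]%classic.
have E0 t : E t 0 by exists 0%N, (fun=> 0), (fun=> 0); split; [exact: itv_family0|rewrite increments0].
have Eb t : t <= b -> ubound (E t) K.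
  by move=> tb _ [n [x [y [H ->]]]]; apply: HK; exact: itv_family_widen H.
have Es t : t <= b -> has_sup (E t).
  by move=> tb; split; [exists 0; exact: E0|exists K; exact: Eb].
pose P t := sup (E t).
have PE t n (x y : 'I_n -> R) : t <= b -> itv_family a t x y -> increments F x y <= P t.
  by move=> tb H; apply: (sup_upper_bound (Es _ tb)); exists n, x, y.
have P0 t : t <= b -> 0 <= P t by move=> tb; apply: (sup_upper_bound (Es _ tb)); exact: E0.
have Pcat s t n (x y : 'I_n -> R) : a <= s -> s <= t -> t <= b -> itv_family s t x y ->
    increments F x y <= P t - P s.
  move=> as_ st tb H; rewrite lerBrDl -lerBrDr.
  apply: ge_sup; first by exists 0; exact: E0.
  move=> _ [m [x' [y' [H' ->]]]]; rewrite lerBrDr.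
  by have [k [z [w [Hz <-]]]] := itv_family_cat F as_ st H' H; apply: PE.
have ndP s t : a <= s -> s <= t -> t <= b -> P s <= P t.
  move=> as_ st tb; rewrite -subr_ge0; apply: le_trans (Pcat s t 0 _ _ as_ st tb (itv_family0 _ _)).
  by rewrite increments0.
exists P; split => //.
  move=> s t as_ st tb.
  have H : itv_family s t (fun _ : 'I_1 => s) (fun=> t).
    by split => // i j _ _ _; rewrite !ord1.
  have := Pcat s t 1 _ _ as_ st tb H; rewrite /increments big_ord1; lra.
move=> e e0; have e2 : 0 < e / 2 by rewrite divr_gt0.
have [_ [n [x [y [Hf ->]]]] HS] := sup_adherent e2 (Es b (lexx b)).
(* [FS t] is the sum of F over the near-optimal family cut at t. By [FSi], [P \- FS] is
   nondecreasing on [a, b]; it grows by less than e / 2 there, since the family almost attains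
   [P b]. *)
pose FS t := increments F (fun i => Num.min (x i) t) (fun i => Num.min (y i) t).
have FSi s t : a <= s -> s <= t -> t <= b -> FS t - FS s <= P t - P s.
  move=> as_ st tb.
  have at_ := le_trans as_ st.
  have H1 := itv_family_min at_ Hf.
  apply: le_trans (Pcat s t n _ _ as_ st tb (itv_family_max st H1)).
  rewrite {1}/FS (increments_min_max F s) addrC.
  have -> : increments F (fun i => Num.min (Num.min (x i) t) s)
      (fun i => Num.min (Num.min (y i) t) s) = FS s; last by rewrite addKr.
  by apply: eq_bigr => i _; rewrite -!minA (min_r st).
have FSb : FS b = increments F x y.
  apply: eq_bigr => i _; have [_ xy yb] := proj1 Hf i.
  by rewrite !min_l// (le_trans xy).
have FSa : FS a = 0.
  rewrite /FS /increments big1// => i _; have [ax xy _] := proj1 Hf i.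
  by rewrite !min_r ?subrr// (le_trans ax).
(* Each of the n intervals of the near-optimal family will contribute two cut sums of this size; n +
   1 covers n = 0 and makes the total strictly smaller than e / 2. *)
have k0 : 0 < e / 2 / (2 * n.+1%:R) by rewrite !divr_gt0// mulr_gt0.
have [d d0 Hd] := abs_continuous_increments acF k0.
exists d => // m c c' Hc Tc Lc.
have Hcc : itv_family a b c c' by [].
have -> : \sum_(i < m) `|P (c' i) - P (c i)| =
    increments (P \- FS) c c' + increments FS c c'.
  rewrite /increments -big_split/=; apply: eq_bigr => i _.
  have [? ? ?] := Hc i; rewrite ger0_norm ?subr_ge0 ?ndP//; lra.
have I1 : increments (P \- FS) c c' <= (P b - FS b) - (P a - FS a).
  apply: increments_nondecreasing => // s t as_ st tb /=.
  have := FSi _ _ as_ st tb; lra.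
have Pa : 0 <= P a by exact: P0.
have I3 (z : R) : a <= z -> z <= b -> `|increments F (fun j => Num.min z (c j)) (fun j => Num.min z (c' j))|
    < e / 2 / (2 * n.+1%:R).
  move=> az zb; have Hz := itv_family_min az Hcc.
  have := Hd m (fun j => Num.min (c j) z) (fun j => Num.min (c' j) z)
    (itv_family_widen (lexx a) zb Hz).
  have L : \sum_(i < m) (Num.min (c' i) z - Num.min (c i) z) < d.
    apply: le_lt_trans Lc; apply: ler_sum => i _; have [_ + _] := Hc i.
    by case: (leP (c i) z); case: (leP (c' i) z); lra.
  move=> /(_ L)[A B].
  have -> : increments F (fun j => Num.min z (c j)) (fun j => Num.min z (c' j)) =
    increments F (fun j => Num.min (c j) z) (fun j => Num.min (c' j) z).
    by apply: eq_bigr => j _; rewrite minC [Num.min z _]minC.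
  by rewrite ltr_norml A andbT ltrNl.
(* Exchanging the sums, interval i contributes the difference of the sums of F over the family (c,
   c') cut at [y i] and at [x i]; both are small by [I3]. *)
have I2 : increments FS c c' <= \sum_(i < n) (e / 2 / n.+1%:R).
  have -> : increments FS c c' = \sum_(i < n)
    (increments F (fun j => Num.min (y i) (c j)) (fun j => Num.min (y i) (c' j)) -
     increments F (fun j => Num.min (x i) (c j)) (fun j => Num.min (x i) (c' j))).
    rewrite /increments /FS; under [RHS]eq_bigr do rewrite /increments -sumrB.
    rewrite [RHS]exchange_big; apply: eq_bigr => j _ /=.
    rewrite /increments -sumrB; apply: eq_bigr => i _; lra.
  apply: ler_sum => i _; have [ax xy yb] := proj1 Hf i.
  have := I3 (y i) (le_trans ax xy) yb; have := I3 (x i) ax (le_trans xy yb).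
  rewrite !ltr_norml => /andP[A1 A2] /andP[B1 B2].
  have -> : e / 2 / n.+1%:R = 2 * (e / 2 / (2 * n.+1%:R)).
    by field; rewrite ?pnatr_eq0 addrC natr1 pnatr_eq0.
  by rewrite mulr_natl mulr2n lerD// ltW// -ltrNl.
have I4 : \sum_(i < n) (e / 2 / n.+1%:R) < e / 2.
  rewrite sumr_const card_ord -[X in X < _]mulr_natr mulrAC ltr_pdivrMr ?ltr0n//.
  by rewrite ltr_pM2l// ltr_nat.
move: HS; rewrite -/(P b) -FSb => HS; lra.
Qed.

End positive_variation.

(** * Stieltjes measures of absolutely continuous functions *)

Section abs_continuous_radon_nikodym.
Variable R : realType.
Implicit Types (F G : R -> R) (a b c d s t : R).
Local Notation mu := (@lebesgue_measure R).

(** Stieltjes measures are computed on ]c, d], lengths and disjointness on ]c, d[, hence one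
    inclusion for each. The degenerate pair a, a serves for an empty I. *)
Lemma open_interval_bounds (I : set R) a b : open I -> is_interval I ->
  I `<=` `]a, b[%classic -> a <= b ->
  exists c d, [/\ a <= c, c <= d, d <= b, I `<=` `]c, d]%classic & `]c, d[%classic `<=` I].
Proof.
move=> oI iI Iab ab; have [[x Ix]|/forallNP I0] := pselect (I !=set0); last first.
  exists a, a; split => //; first by move=> z /I0.
  by move=> z /=; rewrite in_itv/= => /andP[/lt_trans h /h]; rewrite ltxx.
have hi : has_inf I.
  by split; [exists x|exists a => z /Iab /=; rewrite in_itv/= => /andP[/ltW]].
have hs : has_sup I.
  by split; [exists x|exists b => z /Iab /=; rewrite in_itv/= => /andP[_ /ltW]].
have infI z : I z -> inf I <= z by move=> Iz; apply: inf_lbound => //; exact: hi.2.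
have supI z : I z -> z <= sup I by move=> Iz; apply: sup_upper_bound.
exists (inf I), (sup I); split.
- by apply: lb_le_inf; [exists x|move=> z /Iab /=; rewrite in_itv/= => /andP[/ltW]].
- exact: le_trans (infI _ Ix) (supI _ Ix).
- by apply: ge_sup; [exists x|move=> z /Iab /=; rewrite in_itv/= => /andP[_ /ltW]].
- move=> z Iz /=; rewrite in_itv/= supI// andbT lt_neqAle infI// andbT.
  apply/eqP => iz; rewrite -iz in Iz.
  have /nbhs_ballP[r /= r0 Hr] : nbhs (inf I) I by exact: open_nbhs_nbhs.
  have : I (inf I - r / 2).
    apply: Hr; rewrite /ball/= opprB addrC subrK gtr0_norm ?divr_gt0//.
    by rewrite ltr_pdivrMr// ltr_pMr// ltr1n.
  by move=> /infI; rewrite lerBrDr gerDl leNgt divr_gt0.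
- move=> z /=; rewrite in_itv/= -subr_gt0 -(subr_gt0 z) => /andP[iz zs].
  have [y Iy yz] := @inf_adherent _ _ (z - inf I) iz hi.
  have [w Iw wz] := @sup_adherent _ _ (sup I - z) zs hs.
  apply: iI Iy Iw _ _; move: yz wz; rewrite addrC subrK subKr => /ltW -> /ltW ->//.
Qed.

Lemma stieltjes_ocitv (G : cumulative R R) s t : s <= t ->
  lebesgue_stieltjes_measure G `]s, t]%classic = (G t - G s)%:E.
Proof.
move=> st; rewrite /lebesgue_stieltjes_measure /measure_extension measurable_mu_extE/=.
  exact: wlength_itv_bnd.
exact: is_ocitv.
Qed.

(** Outer regularity encloses N in an open set of measure below d, whose trace on ]a, b[ is a
    countable disjoint union of intervals. Every finite subfamily has total length below d, so
    absolute continuity bounds its Stieltjes measure by e; the partial sums then pass to the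
    limit. *)
Lemma stieltjes_null (G : cumulative R R) a b : a <= b -> abs_continuous_on a b G ->
  forall N : set (measurableTypeR R), measurable N -> N `<=` `]a, b[%classic -> mu N = 0%E ->
  lebesgue_stieltjes_measure G N = 0%E.
Proof.
move=> ab acG N mN Nab N0; apply/eqP; rewrite eq_le measure_ge0 andbT.
apply/lee_addgt0Pr => e e0; rewrite add0e.
have [d d0 Hd] := abs_continuous_increments acG e0.
have [U [oU NU Ud]] : exists U, [/\ open U, N `<=` U & (mu U < d%:E)%E].
  have Noo : (mu N < +oo)%E by rewrite N0.
  have [U [oU NU Ud]] := lebesgue_regularity_outer mN Noo d0.
  exists U; split => //.
  have -> : U = N `|` (U `\` N) by rewrite setDUK.
  by rewrite (le_lt_trans (measureU2 _ _ _))//= ?N0 ?add0e//;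
    [exact: measurableD (open_measurable oU) mN].
pose V := U `&` `]a, b[%classic.
have oV : open V by apply: openI => //; exact: itv_open.
have mV : measurable (V : set (measurableTypeR R)) by exact: open_measurable.
pose I := open_disjoint_itv oV.
have oI q : open (I q) by exact: open_disjoint_itv_open.
have mI q : measurable (I q : set (measurableTypeR R)) by exact: open_measurable.
have VI : V = \bigcup_q I q by exact: open_disjoint_itv_bigcup.
have tI : trivIset [set: nat] I by exact: open_disjoint_itv_trivIset.
have Iab q : I q `<=` `]a, b[%classic.
  by move=> z Iz; have [] : V z by rewrite VI; exists q.
have /choice[c Hc] : forall q, exists c : R * R, [/\ a <= c.1, c.1 <= c.2, c.2 <= b,
    I q `<=` `]c.1, c.2]%classic & `]c.1, c.2[%classic `<=` I q].
  move=> q; have [x [y H]] := open_interval_bounds (oI q)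
    (@open_disjoint_itv_is_interval _ _ oV q) (@Iab q) ab.
  by exists (x, y).
have NV : N `<=` V by move=> z Nz; split; [exact: NU|exact: Nab].
apply: (@le_trans _ _ (lebesgue_stieltjes_measure G V)).
  by apply: le_measure; rewrite ?inE.
have : (lebesgue_stieltjes_measure G V <= \sum_(q <oo) lebesgue_stieltjes_measure G (I q))%E.
  by apply: measure_sigma_subadditive => //; rewrite VI.
move=> /le_trans; apply; apply: lime_le; first exact: is_cvg_nneseries.
apply: nearW => n; rewrite big_mkord.
pose x (i : 'I_n) := (c i).1; pose y (i : 'I_n) := (c i).2.
have Hf : itv_family a b x y.
  split; first by move=> i; have [] := Hc i.
  move=> i j _ _ [z [zi zj]]; apply/val_inj/tI => //.
  by exists z; split; [have [_ _ _ _] := Hc i|have [_ _ _ _] := Hc j]; apply.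
have L : \sum_(i < n) (y i - x i) < d.
  rewrite -lte_fin; apply: le_lt_trans Ud.
  apply: (@le_trans _ _ (mu (\big[setU/set0]_(i < n) I i))); last first.
    apply: le_measure; rewrite ?inE; [exact: bigsetU_measurable|exact: open_measurable|].
    apply: (@subset_trans _ V); last exact: subIsetl.
    by rewrite VI; exact: bigsetU_bigcup.
  rewrite measure_semi_additive_ord//; last 2 first.
  - by move=> i j _ _ ij; apply/val_inj; exact: tI ij.
  - exact: bigsetU_measurable.
  rewrite -sumEFin; apply: lee_sum => i _.
  have [_ xy _ _ sub] := Hc i.
  have <- : mu `]x i, y i[%classic = (y i - x i)%:E.
    by rewrite lebesgue_measure_itv/= lte_fin lt_neqAle xy andbT; case: eqP => //= ->; rewrite subrr.
  by apply: le_measure; rewrite ?inE.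
have [H _] := Hd _ _ _ Hf L.
apply: (@le_trans _ _ (\sum_(i < n) (G (y i) - G (x i))%:E)%E); last first.
  by rewrite sumEFin lee_fin ltW.
apply: lee_sum => i _; have [_ xy _ sub _] := Hc i.
rewrite -stieltjes_ocitv//; apply: le_measure; rewrite ?inE//.
Qed.

End abs_continuous_radon_nikodym.

(** * Absolutely continuous functions as integrals of their derivatives *)

Section abs_continuous_integral.
Variable R : realType.
Implicit Types (F G h : R -> R) (a b c d s t : R).
Local Notation mu := (@lebesgue_measure R).

Lemma abs_continuous_continuous F a b t (e : R) : abs_continuous_on a b F -> 0 < e ->
  exists2 d : R, 0 < d & forall s t, a <= s -> s <= t -> t <= b -> t - s < d ->
    `|F t - F s| < e.
Proof.
move=> /[apply] -[d d0 Hd]; exists d => // s r as_ sr rb srd.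
have := Hd 1 (fun=> s) (fun=> r); rewrite !big_ord1; apply => //.
by move=> i j _ _ _; rewrite !ord1.
Qed.

(* g is the Radon-Nikodym derivative of the Stieltjes measure of F. *)
Lemma abs_continuous_nondecreasing_integral F a b b' : a <= b -> b < b' ->
  (forall s t, a <= s -> s <= t -> t <= b' -> F s <= F t) ->
  abs_continuous_on a b' F ->
  exists g : R -> R, mu.-integrable `[a, b] (EFin \o g) /\
    forall t, a <= t <= b -> F t - F a = intg g a t.
Proof.
move=> ab bb' ndF acF; have ab' : a <= b' by rewrite (le_trans ab)// ltW.
(* Clamping extends F to a continuous nondecreasing function on R. As b < b', null subsets of ]a, b]
   lie in ]a, b'[, as [stieltjes_null] asks. *)
pose cl t := Num.max a (Num.min t b').
have cla t : a <= cl t by rewrite le_max lexx.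
have clb t : cl t <= b' by rewrite ge_max ab' ge_min lexx orbT.
have ndcl s t : s <= t -> cl s <= cl t.
  by move=> st; rewrite ge_max !le_max lexx/= le_min !ge_min st lexx !orbT.
have cldist s t : s <= t -> cl t - cl s <= t - s.
  rewrite /cl => st; have [x|x] := leP t b'; have [y|y] := leP s b';
  rewrite /Num.max; repeat case: ifP => /=; lra.
have clE t : a <= t <= b' -> cl t = t by move=> /andP[at_ tb]; rewrite /cl min_l// max_r.
pose G t := F (cl t).
have ndG : nondecreasing G by move=> s t st; apply: ndF => //; exact: ndcl.
have cG : continuous G.
  move=> x; apply/cvgrPdist_lt => e e0; have [d d0 Hd] := abs_continuous_continuous x acF e0.
  exists d => //= z; rewrite /ball/= => xz.
  have [zx|zx] := leP z x.
    apply: Hd => //; first exact: ndcl.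
    by rewrite (le_lt_trans (cldist _ _ zx))// (le_lt_trans (ler_norm _)).
  rewrite distrC; apply: Hd => //; first exact/ndcl/ltW.
  by rewrite (le_lt_trans (cldist _ _ (ltW zx)))// (le_lt_trans (ler_norm _))// distrC.
pose Gc : cumulative R R := HB.pack G
  (isCumulative.Build R _ R G ndG (right_continuousW cG)).
have acG : abs_continuous_on a b' Gc.
  move=> e /acF[d d0 Hd]; exists d => // n x y H T L.
  apply: le_lt_trans (Hd n x y H T L); apply: ler_sum => i _; have [ax xy yb] := H i.
  by rewrite /= /G !clE// ?ax ?yb ?(le_trans ax)// ?(le_trans xy).
pose nu := lebesgue_stieltjes_measure Gc.
have mD : measurable (`]a, b]%classic : set (measurableTypeR R)) by [].
have nuD : (nu `]a, b]%classic < +oo)%E by rewrite /nu stieltjes_ocitv// ltry.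
pose nuf : {finite_measure set _ -> \bar R} := mfrestr mD nuD.
have dom : nuf `<< mu.
  apply/null_content_dominatesP => N mN N0; rewrite /nuf/= /mfrestr /mrestr.
  apply: (stieltjes_null ab' acG) => //; first exact: measurableI.
    move=> z [_] /=; rewrite !in_itv/= => /andP[-> zb].
    exact: le_lt_trans bb'.
  by apply/eqP; rewrite -measure_le0 -N0; apply: le_measure; rewrite ?inE//; exact: measurableI.
have [f [f0 ffin intf Hf]] := radon_nikodym_sigma_finite dom.
have fE : EFin \o (fine \o f) = f by apply/funext => x /=; rewrite fineK.
exists (fine \o f); split.
  by rewrite fE; apply: integrableS intf.
move=> t /andP[at_ tb].
rewrite /intg /Rintegral; have -> : (\int[mu]_(x in `[a, t]) ((fine \o f) x)%:E =
   \int[mu]_(x in `]a, t]) f x)%E.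
  rewrite -integral_itv_obnd_cbnd; last first.
    rewrite (_ : (fun x => _) = f)//; apply: measurable_funTS; exact: measurable_int intf.
  by apply: eq_integral => x _; rewrite /= fineK.
rewrite -Hf// /nuf/= /mfrestr /mrestr /= setIidl; last by apply: subset_itvl; rewrite bnd_simp.
rewrite /nu stieltjes_ocitv//= /G !clE//; first by rewrite lexx.
by rewrite at_ (le_trans tb)// ltW.
Qed.

Lemma abs_continuous_integral F a b b' : a <= b -> b < b' ->
  abs_continuous_on a b' F ->
  exists g : R -> R, mu.-integrable `[a, b] (EFin \o g) /\
    forall t, a <= t <= b -> F t - F a = intg g a t.
Proof.
move=> ab bb' acF; have ab' : a <= b' by rewrite (le_trans ab)// ltW.
have [P [ndP ndPF acP]] := abs_continuous_split ab' acF.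
have [g [ig gE]] := abs_continuous_nondecreasing_integral ab bb' ndP acP.
have [h [ih hE]] := abs_continuous_nondecreasing_integral ab bb' ndPF (abs_continuous_onB acP acF).
exists (g \- h); split.
  by apply: eq_integrable (integrableB _ ig ih) => //= x _.
move=> t /[dup] /andP[at_ tb] /[dup] /gE {}gE /hE {}hE.
rewrite /intg RintegralB//.
- by rewrite -/(intg g a t) -/(intg h a t) -gE -hE; ring.
- by apply: integrableS ig => //; apply: subset_itvl; rewrite bnd_simp.
- by apply: integrableS ih => //; apply: subset_itvl; rewrite bnd_simp.
Qed.

Lemma ae_neq c : {ae mu, forall x, x <> c}.
Proof.
exists [set c]; split => //; first exact: lebesgue_measure_set1.
by move=> x /= /contrapT.
Qed.

Lemma Lloc_measurable h : Lloc [set: R] h -> measurable_fun [set: R] h.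
Proof.
move=> H; rewrite -(bigcup_itvT false false); apply/measurable_fun_bigcup => // n.
by apply/measurable_EFinP; have /measurable_int := Lloc_itv (- n%:R) n%:R H;
  apply: measurable_funS => //; apply: subset_itvr; rewrite bnd_simp.
Qed.

Lemma Lloc_locally_integrable h : Lloc [set: R] h -> locally_integrable [set: R] h.
Proof.
move=> H; split; [exact: Lloc_measurable|exact: openT|move=> K _ cK].
have [M [Mr HM]] := compact_bounded cK.
have KM : K `<=` `[- (M + 1), M + 1]%classic.
  move=> x Kx /=; rewrite in_itv/= -ler_norml; apply: HM => //.
  by rewrite ltrDl.
have /integrableP[_] := Lloc_itv (- (M + 1)) (M + 1) H.
apply: le_lt_trans; apply: ge0_subset_integral => //.
  exact: compact_measurable.
by apply/measurable_EFinP/measurableT_comp => //; exact: measurable_funTS (Lloc_measurable H).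
Qed.

Lemma derive_intg h a : Lloc [set: R] h ->
  {ae mu, forall x, a < x -> is_derive x 1 (intg h a) (h x)}.
Proof.
move=> H; have := @FTC1 R h (BLeft a) (fun y => Lloc_itv a y H) (Lloc_locally_integrable H).
move=> /= F1; apply: (aeS F1) => x + ax.
rewrite lte_fin => /(_ ax)[D E].
by apply: DeriveDef; [exact: D|rewrite -derive1E; exact: E].
Qed.

(** On [s, t] the increments of F are integrals of a density g. At almost every interior point F is
    differentiable with derivative g, so g <= h almost everywhere, and this inequality can be
    integrated. *)
Lemma abs_continuous_le F h : ACloc [set: R] [set: R] F -> Lloc [set: R] h ->
  {ae mu, forall t, derive1 F t <= h t} ->
  forall s t, s <= t -> F t - F s <= intg h s t.
Proof.
move=> [_ acF] H Fh s t st.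
have tt : t < t + 1 by rewrite ltrDl.
have [g [ig gE]] := abs_continuous_integral st tt (acF s (t + 1) (@subsetT _ _)).
pose g' := g \_ `[s, t].
have H' : Lloc [set: R] g'.
  apply/LlocT => a b.
  have : mu.-integrable [set: R] (EFin \o g').
    have mst : measurable (`[s, t] : set (measurableTypeR R)) by [].
    have := (integrable_mkcond (mu := mu) (EFin \o g) mst).1 ig.
    by rewrite restrict_EFin.
  by apply: integrableS.
have g'E r : s <= r <= t -> intg g s r = intg g' s r.
  move=> /andP[sr rt]; apply: eq_Rintegral => x; rewrite inE/= in_itv/= => /andP[sx xr].
  by rewrite /g' patchE ifT// inE/= in_itv/= sx (le_trans xr).
rewrite gE ?st ?lexx// g'E ?st ?lexx//; apply: le_intg => //.
apply: (aeS (aeI (derive_intg s H') (aeI Fh (aeI (ae_neq s) (ae_neq t))))) => x.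
move=> [D [Fhx [/eqP xs /eqP xt]]] /andP[sx' xt'].
have sx : s < x by rewrite lt_neqAle eq_sym xs.
have {xt' xt} xt : x < t by rewrite lt_neqAle xt.
apply: le_trans Fhx; rewrite derive1E.
have Dx := D sx.
suff -> : 'D_1 F x = g' x by [].
have <- : 'D_1 (fun r => F s + intg g' s r) x = g' x.
  have := is_deriveD (is_derive_cst (F s) x 1) Dx.
  by move=> /@derive_val ->; rewrite add0r.
apply: near_eq_derive; near=> r.
have srt : s <= r <= t.
  by apply/andP; split; apply: ltW; near: r; [exact: lt_nbhsr|exact: lt_nbhsl].
by rewrite -g'E// -gE// addrC subrK.
Unshelve. all: by end_near. Qed.

End abs_continuous_integral.

(** * Compactness and delayed approximations *)

Section compact_convergence.
Variable R : realType.
Implicit Types (u v : R -> R) (T : (R -> R) -> R -> R) (a b s t : R).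
Local Notation mu := (@lebesgue_measure R).

(** The sets [B] generate a filter that converges to u uniformly on compact sets, so every
    neighbourhood of u contains one of them. *)
Lemma family_compact_nbhs u (P : set (R -> R)) :
  nbhs (u : {family compact, R -> R}) P ->
  exists (N d : R), 0 < d /\
    forall v, (forall s, - N <= s <= N -> `|v s - u s| < d) -> P v.
Proof.
pose B (p : R * R) := [set v : R -> R | forall s, - p.1 <= s <= p.1 -> `|v s - u s| < p.2].
pose F := filter_from [set p : R * R | 0 < p.2] B.
have FF : Filter F.
  apply: filter_from_filter; first by exists (0, 1) => /=.
  move=> p q /= p0 q0; exists (Num.max p.1 q.1, Num.min p.2 q.2); rewrite /= ?lt_min ?p0//.
  move=> v Hv; split => s /andP[s1 s2].
    have := Hv s; rewrite lt_min => /(_ _)/andP[]//=; rewrite lerNl le_max -lerNl s1/=.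
    by rewrite le_max s2.
  have := Hv s; rewrite lt_min => /(_ _)/andP[]//=; rewrite lerNl le_max -[_ <= q.1]lerNl s1 orbT/=.
  by rewrite le_max s2 orbT.
suff Fu : F --> (u : {family compact, R -> R}).
  by move=> /Fu [[N d] /= d0 H]; exists N, d.
apply/fam_cvgP => K cK A /uniform_nbhs [E [+ EA]].
rewrite -entourage_ballE => -[e /= e0 He].
have [M [Mr HM]] := compact_bounded cK.
exists (M + 1, e) => // v Hv; apply: EA => y Ky; apply: He => /=.
rewrite /ball/= distrC; apply: Hv => /=; rewrite -ler_norml; apply: HM => //.
by rewrite ltrDl.
Qed.

Lemma family_compact_ball u (N d : R) : 0 < d ->
  nbhs (u : {family compact, R -> R})
    [set v | forall s, - N <= s <= N -> `|v s - u s| < d].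
Proof.
move=> d0; have entE : entourage [set xy : R * R | ball xy.1 d xy.2].
  by rewrite -entourage_ballE; exists d.
apply: filterS (fam_nbhs u entE (@segment_compact R (- N) N)) => v Hv s sN.
by have := Hv s; rewrite /= in_itv/= => /(_ sN); rewrite /ball/= distrC.
Qed.

(** An epsilon form of the continuity in [continuous_operator] that passes to sums and to
    composition with truncations. *)
Definition L1_continuous T : Prop := forall u, continuous u ->
  forall a b e : R, 0 < e -> exists (N d : R), 0 < d /\ forall v, continuous v ->
    (forall s, - N <= s <= N -> `|v s - u s| < d) ->
    intg (fun t => `|T v t - T u t|) a b < e.

Definition locally_uniform_cvg (u_ : nat -> R -> R) u : Prop :=
  forall N e : R, 0 < e -> exists j0 : nat, forall j, (j0 <= j)%N ->
    forall s, - N <= s <= N -> `|u_ j s - u s| < e.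

Lemma continuous_operator_L1 T : continuous_operator T -> L1_continuous T.
Proof.
move=> [LT cT] u cu a b e e0; have := cT u cu a b.
move=> /(_ [set x | (x < e%:E)%E]) H.
have : nbhs (0%E : \bar R) [set x | (x < e%:E)%E] by apply: open_nbhs_nbhs; split;
  [exact: open_ereal_lt_ereal|rewrite /= lte_fin].
move=> /H /family_compact_nbhs [N [d [d0 Hd]]]; exists N, d; split => // v cv Hv.
have LB : Lloc [set: R] (fun t => `|T v t - T u t|).
  by apply: (@Lloc_norm _ (T v \- T u)); apply: LlocB; exact: LT.
rewrite -lte_fin; have := Hd v Hv cv; rewrite /intg /Rintegral fineK//.
by apply: integrable_fin_num => //; exact: Lloc_itv.
Qed.

(** Ascoli's theorem on R. Bounds and moduli are asked only for [n0 <= n], since an approximation is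
    controlled on [-N, N] only once its own interval contains it; the finitely many others are
    treated one by one. [phi] need not increase: [j <= phi j] is enough to take limits. *)
Lemma locally_uniform_subsequence (u_ : nat -> R -> R) :
  (forall n, continuous (u_ n)) ->
  (forall N : R, exists (M : R) (n0 : nat), forall n, (n0 <= n)%N ->
     forall s, - N <= s <= N -> `|u_ n s| <= M) ->
  (forall N e : R, 0 < e -> exists2 d : R, 0 < d & exists n0 : nat, forall n, (n0 <= n)%N ->
     forall s t, - N <= s <= N -> - N <= t <= N -> `|s - t| < d -> `|u_ n s - u_ n t| < e) ->
  exists (phi : nat -> nat) u, [/\ continuous u, forall j, (j <= phi j)%N &
    locally_uniform_cvg (u_ \o phi) u].
Proof.
move=> cu bu eu.
pose W : set (R -> R) := range u_.
have ptW : pointwise_precompact W id.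
  move=> x; have [M [n0 HM]] := bu `|x|.
  have xx : - `|x| <= x <= `|x| by rewrite -ler_norml.
  pose M' := \sum_(i < n0) `|u_ i x| + Num.max M 0.
  apply: (@precompact_subset _ _ `[- M', M']%classic); last first.
    by apply: compact_precompact; [exact: Rhausdorff|exact: segment_compact].
  move=> _ [_ [n _ <-] <-] /=; rewrite in_itv/= -ler_norml /M'.
  have [nn|nn] := leqP n0 n.
    by rewrite (le_trans (HM n nn x xx))// ler_wpDl ?sumr_ge0// le_max lexx.
  rewrite (bigD1 (Ordinal nn))//= -addrA lerDl addr_ge0 ?sumr_ge0//.
  by rewrite le_max lexx orbT.
have eqW : equicontinuous W id.
  move=> x E; rewrite -entourage_ballE => -[e /= e0 He].
  have [d d0 [n0 Hn0]] := eu (`|x| + 1) e e0.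
  have xx : - (`|x| + 1) <= x <= `|x| + 1 by rewrite -ler_norml lerDl.
  have N1 : \forall y \near x, forall n, (n0 <= n)%N -> `|u_ n x - u_ n y| < e.
    near=> y => n nn.
    have y1 : `|x - y| < 1 by near: y; exact: nbhsx_ballx.
    have y2 : `|x - y| < d by near: y; exact: nbhsx_ballx.
    apply: Hn0 => //; rewrite -ler_norml -(subrK x y) addrC (le_trans (ler_normD _ _))// lerD2l.
    by rewrite distrC ltW.
  have N2 : \forall y \near x, forall i : 'I_n0, `|u_ i x - u_ i y| < e.
    have H := @filter_forall _ _ (fun (i : 'I_n0) y => `|u_ i x - u_ i y| < e) _ (nbhs_filter x).
    by apply: H => i; move/cvgrPdist_lt : (cu i x); apply.
  near=> y => _ [n _ <-]; apply: He; rewrite /ball/=.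
  have [nn|nn] := leqP n0 n.
    have : forall n, (n0 <= n)%N -> `|u_ n x - u_ n y| < e by near: y.
    exact.
  have H : forall i : 'I_n0, `|u_ i x - u_ i y| < e by near: y.
  exact: (H (Ordinal nn)).
have := @pointwise_precompact_equicontinuous _ _ (@Rhausdorff R) W ptW eqW.
rewrite precompactE => cW.
pose F : set_system {family compact, R -> R} := u_ @ \oo.
have FW : F (closure (W : set {family compact, R -> R})).
  by exists 0%N => // n _; apply: subset_closure; exists n.
have [u [_ clu]] := cW F _ FW.
have near_u (N e : R) (n : nat) : 0 < e -> exists m, (n <= m)%N /\
    forall s, - N <= s <= N -> `|u_ m s - u s| < e.
  move=> e0; have Fn : F [set v | exists2 m, (n <= m)%N & v = u_ m].
    by exists n => // m nm; exists m.
  have [_ [[m nm ->] H]] := clu _ _ Fn (family_compact_ball u N e0).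
  by exists m.
(* Since u is a cluster point, closeness 1 / (j + 1) on [-j, j] can be required at step j, which
   gives convergence on all compact sets at once. *)
have /choice[phi Hphi] : forall j : nat, exists m, (j <= m)%N /\
    forall s, - j%:R <= s <= j%:R -> `|u_ m s - u s| < j.+1%:R^-1.
  by move=> j; apply: near_u; rewrite invr_gt0.
have conv (N e : R) : 0 < e -> exists j0 : nat, forall j, (j0 <= j)%N ->
      forall s, - N <= s <= N -> `|u_ (phi j) s - u s| < e.
  move=> e0; exists (maxn (Num.bound N) (Num.bound e^-1)) => j; rewrite geq_max => /andP[j1 j2].
  move=> s /andP[s1 s2]; have [_ H] := Hphi j.
  have Nj : N <= j%:R.
    have [N0|N0] := leP 0 N; last by rewrite (le_trans (ltW N0)).
    by rewrite (le_trans (ltW (archi_boundP N0)))// ler_nat.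
  apply: lt_le_trans (H s _) _; first by rewrite (le_trans _ s1) ?lerN2// (le_trans s2).
  have ei : e^-1 <= j.+1%:R.
    have e1 : 0 <= e^-1 by rewrite invr_ge0 ltW.
    by rewrite (le_trans (ltW (archi_boundP e1)))// ler_nat (leq_trans j2).
  by rewrite -[leRHS]invrK lef_pV2 ?posrE ?invr_gt0.
exists phi, u; split => //; last by move=> j; have [] := Hphi j.
move=> x; apply/cvgrPdist_lt => e e0; have e3 : 0 < e / 3 by rewrite divr_gt0.
have [j0 Hj0] := conv (`|x| + 1) _ e3.
have {Hj0} := Hj0 j0 (leqnn _); set w := u_ (phi j0) => Hw.
have cw : continuous w by exact: cu.
have /cvgrPdist_lt /(_ _ e3) Hc := cw x.
have H1 : \forall y \near nbhs x, `|x - y| < 1 by exact: nbhsx_ballx.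
near=> y.
have y1 : `|x - y| < 1 by near: y.
have Hx : `|w x - u x| < e / 3 by apply: Hw; rewrite -ler_norml lerDl.
have Hy : `|w y - u y| < e / 3.
  apply: Hw; rewrite -ler_norml -(subrK x y) addrC (le_trans (ler_normD _ _))// lerD2l.
  by rewrite distrC ltW.
have Hxy : `|w x - w y| < e / 3 by near: y.
have -> : u x - u y = - (w x - u x) + (w x - w y) + (w y - u y) by ring.
rewrite (le_lt_trans (ler_normD _ _))// (le_lt_trans (lerD (ler_normD _ _) (lexx _)))//.
by rewrite normrN; lra.
Unshelve. all: by end_near. Qed.

Lemma locally_uniform_cvg_pointwise (u_ : nat -> R -> R) u s :
  locally_uniform_cvg u_ u -> u_ n s @[n --> \oo] --> u s.
Proof.
move=> H; apply/cvgrPdist_lt => e e0; have [j0 Hj] := H `|s| e e0.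
by exists j0 => // j /= jj; rewrite distrC; apply: Hj => //; rewrite -ler_norml.
Qed.

Lemma L1_continuous_cvg T (u_ : nat -> R -> R) u a b :
  L1_continuous T -> (forall v, continuous v -> Lloc [set: R] (T v)) ->
  continuous u -> (forall n, continuous (u_ n)) -> locally_uniform_cvg u_ u ->
  intg (T (u_ n)) a b @[n --> \oo] --> intg (T u) a b.
Proof.
move=> cT LT cu cu_ H; apply/cvgrPdist_lt => e e0.
have [N [d [d0 Hd]]] := cT u cu a b e e0; have [j0 Hj] := H N d d0.
exists j0 => // j /= jj; apply: le_lt_trans (Hd (u_ j) (cu_ j) (Hj j jj)).
have Lu := LT _ cu; have Lj := LT _ (cu_ j).
by rewrite distrC -intgB// norm_intg//; exact: LlocB.
Qed.

End compact_convergence.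

(** * Delayed equations and shooting for a dominated Volterra right-hand side *)

Section tonelli.
Variable R : realType.
Implicit Types (u v : R -> R) (s t : R).
Variables (Phi : (R -> R) -> R -> R) (h : R -> R) (a b : R).
Hypothesis ab : a <= b.
Hypothesis Phi_Lloc : forall u, continuous u -> Lloc [set: R] (Phi u).
Hypothesis Phi_L1 : L1_continuous Phi.
Hypothesis Phi_Volterra : forall zeta u v, continuous u -> continuous v ->
  (forall s, s <= zeta -> u s = v s) ->
  {ae @lebesgue_measure R, forall t, t <= zeta -> Phi u t = Phi v t}.
Hypothesis h_Lloc : Lloc [set: R] h.
Hypothesis Phi_h : forall u, continuous u ->
  {ae @lebesgue_measure R, forall t, `|Phi u t| <= h t}.

Let h_ge0 : {ae @lebesgue_measure R, forall t, 0 <= h t}.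
Proof.
apply: (aeS (Phi_h (fun _ => cvg_cst 0 : {for _, continuous (fun=> 0)}))) => t.
exact: le_trans.
Qed.

Let norm_intg_Phi u s t : continuous u -> `|intg (Phi u) s t| <= intg h s t.
Proof.
move=> cu; have L := Phi_Lloc cu.
apply: le_trans (norm_intg s t L) _; apply: le_intg => //; first exact: Lloc_norm.
by apply: (aeS (Phi_h cu)).
Qed.

Let intg_h_nd s t : s <= t -> intg h a s <= intg h a t.
Proof.
move=> st; have [sa|as_] := leP s a.
  by rewrite intg_eq0//; apply: intg_ge0 => //; apply: (aeS h_ge0).
by apply: le_intg_itv => //; [apply: (aeS h_ge0)|exact: ltW].
Qed.

Let intg_PhiB u s t : continuous u -> s <= t ->
  `|intg (Phi u) a t - intg (Phi u) a s| <= intg h a t - intg h a s.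
Proof.
move=> cu st; have L := Phi_Lloc cu.
have [sa|as_] := leP s a; first by rewrite !(intg_eq0 _ sa) !subr0; exact: norm_intg_Phi.
have aS := ltW as_.
rewrite (intg_cat L aS st) (intg_cat h_Lloc aS st) addrC addKr [X in _ <= X - _]addrC addrK.
exact: norm_intg_Phi.
Qed.

Section delayed.
Variable d : R.
Hypothesis d0 : 0 < d.

(** The upper limit [Num.min t b - d] makes the value at t depend on u up to t - d only, and stops
    the evolution after b, so that bounds hold on all of R. *)
Definition delayed_step x u t := x + intg (Phi u) a (Num.min t b - d).

Definition delayed_iter j x := iter j (delayed_step x) (fun=> x).

Lemma delayed_step_continuous x u : continuous u -> continuous (delayed_step x u).
Proof.
move=> cu t; apply: cvgD; first exact: cvg_cst.
apply: (@continuous_comp _ _ _ (fun t => Num.min t b - d) (intg (Phi u) a)).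
  apply: cvgB; last exact: cvg_cst.
  by apply: continuous_min; [exact: cvg_id|exact: cvg_cst].
exact/continuous_intg/Phi_Lloc.
Qed.

Lemma delayed_iter_continuous j x : continuous (delayed_iter j x).
Proof.
by elim: j => [t|j IH]; [exact: cvg_cst|exact: delayed_step_continuous].
Qed.

Lemma delayed_step_init x u t : t <= a + d -> delayed_step x u t = x.
Proof.
by move=> ta; rewrite /delayed_step intg_eq0 ?addr0// lerBlDr ge_min ta.
Qed.

Lemma delayed_iter_init j x t : t <= a -> delayed_iter j x t = x.
Proof.
case: j => // j ta; rewrite /delayed_iter iterS delayed_step_init//.
by rewrite (le_trans ta)// lerDl ltW.
Qed.

Lemma delayed_step_Volterra x u v zeta t : continuous u -> continuous v ->
  (forall s, s <= zeta -> u s = v s) -> t <= zeta + d ->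
  delayed_step x u t = delayed_step x v t.
Proof.
move=> cu cv uv tz; congr (_ + _); apply: eq_intg; [exact: Phi_Lloc|exact: Phi_Lloc|].
apply: (aeS (Phi_Volterra cu cv uv)) => s + /andP[_ sb]; apply.
by rewrite (le_trans sb)// lerBlDr ge_min tz.
Qed.

(** Each application of [delayed_step] extends by d the half-line on which two arguments give the
    same result. *)
Lemma delayed_iter_stable j x t : t <= a + j%:R * d ->
  delayed_iter j.+1 x t = delayed_iter j x t.
Proof.
elim: j t => [|j IH] t tj.
  rewrite /delayed_iter /= delayed_step_init// (le_trans tj)// mul0r addr0 lerDl.
  exact: ltW.
rewrite [LHS]/delayed_iter iterS [RHS]/delayed_iter iterS -!/(delayed_iter _ _).
apply: (@delayed_step_Volterra _ _ _ (a + j%:R * d)).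
- exact: (@delayed_iter_continuous j.+1).
- exact: delayed_iter_continuous.
- exact: IH.
- by rewrite (le_trans tj)// -natr1 mulrDl mul1r addrA.
Qed.

(** Uniformity in t, available because the integration never goes beyond b, is what lets the
    induction feed [Phi_L1] at the next step. *)
Lemma delayed_iter_dist j x (e : R) : 0 < e -> exists2 r : R, 0 < r &
  forall y, `|y - x| < r -> forall t, `|delayed_iter j y t - delayed_iter j x t| < e.
Proof.
elim: j e => [|j IH] e e0; first by exists e.
have e2 : 0 < e / 2 by rewrite divr_gt0.
have cx := @delayed_iter_continuous j x.
have [N [r [r0 Hr]]] := Phi_L1 cx a b e2.
have [r' r'0 Hr'] := IH r r0.
exists (Num.min r' (e / 2)); first by rewrite lt_min r'0.
move=> y; rewrite lt_min => /andP[yr ye] t.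
rewrite /delayed_iter !iterS -!/(delayed_iter _ _) /delayed_step opprD addrACA.
have cy := @delayed_iter_continuous j y.
have := Hr _ cy (fun s _ => Hr' y yr s).
set z := Num.min t b - d => Hz.
have zb : z <= b by rewrite lerBlDr ge_min lerDl (ltW d0) orbT.
rewrite [e]splitr (le_lt_trans (ler_normD _ _))// ltrD//.
apply: le_lt_trans Hz.
have L := LlocB (Phi_Lloc cy) (Phi_Lloc cx).
rewrite -intgB; [|exact: Phi_Lloc|exact: Phi_Lloc].
apply: le_trans (norm_intg _ _ L) _.
have [za|az] := leP z a; first by rewrite intg_eq0//; apply: intg_ge0 (Lloc_norm L) _; apply: aeW => ? _.
by apply: le_intg_itv (Lloc_norm L) _ _ _ _ => //; [exact: aeW|exact: ltW].
Qed.

End delayed.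

Variables (t0 kappa c : R).
Hypothesis kappa0 : 0 <= kappa.
Hypothesis c0 : 0 <= c.
Hypothesis Phi0 : forall u, continuous u -> (forall s, s <= t0 -> u s = 0) ->
  {ae @lebesgue_measure R, forall t, t <= t0 -> Phi u t = 0}.

(* Shooting on the initial value x: if no x in [0, kappa] gives u t0 = c, then
   x = kappa gives u t0 < c. *)
Lemma delayed_solution (d : R) : 0 < d -> exists (x : R) (u : R -> R),
  [/\ 0 <= x <= kappa, (u t0 <= c /\ (u t0 - c) * (x - kappa) = 0),
      continuous u, (forall t, t <= a -> u t = x) &
      (forall t, t <= b -> u t = x + intg (Phi u) a (t - d)) /\
      (exists2 v, continuous v & u = delayed_step d x v)].
Proof.
move=> d0; have [J [J0 HJ]] : exists J : nat, (0 < J)%N /\ b <= a + J%:R * d.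
  exists (Num.bound ((b - a) / d)).+1; split => //.
  rewrite -lerBlDl -ler_pdivrMr// (le_trans (ltW (archi_boundP _))) ?ler_nat//.
  by rewrite divr_ge0 ?(ltW d0)// subr_ge0.
pose g x := delayed_iter d J x t0.
have cg : continuous g.
  move=> x; apply/cvgrPdist_lt => e e0; have [r r0 Hr] := delayed_iter_dist d0 J x e0.
  by exists r => //= y; rewrite /ball/= => xy; rewrite distrC; apply: Hr; rewrite distrC.
(* A zero past stays zero up to t0 by [Phi0]; this gives the lower end of the shooting. *)
have g0 : g 0 = 0.
  rewrite /g; have : forall t, t <= t0 -> delayed_iter d J 0 t = 0; last exact.
  elim: (J) => // j IH t tt; rewrite /delayed_iter iterS -/(delayed_iter _ _ _).
  rewrite /delayed_step add0r.
  have cj := @delayed_iter_continuous d j 0.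
  rewrite (@eq_intg _ _ (fun=> 0)); first by rewrite /intg Rintegral_cst// mul0r.
  - exact: Phi_Lloc.
  - by apply: Lloc_continuous => ?; exact: cvg_cst.
  - apply: (aeS (Phi0 cj IH)) => s + /andP[_ sb]; apply.
    by rewrite (le_trans sb)// lerBlDr ge_min (le_trans tt)// lerDl ltW.
have [x [x0 xk gc gk]] : exists x : R, [/\ 0 <= x, x <= kappa, g x <= c & (g x - c) * (x - kappa) = 0].
  have [gk|gk] := leP (g kappa) c.
    by exists kappa; rewrite subrr mulr0.
  have [|x xk gx] := @IVT R g 0 kappa c kappa0 (continuous_subspaceT cg).
    by rewrite g0 ge_min c0 le_max (ltW gk) orbT.
  move: xk; rewrite in_itv/= => /andP[x0 xk].
  by exists x; rewrite gx subrr mul0r.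
exists x, (delayed_iter d J x); split => //.
- by rewrite x0.
- exact: delayed_iter_continuous.
- by move=> t; exact: delayed_iter_init.
split.
  move=> t tb; rewrite -{1}(delayed_iter_stable d0) ?(le_trans tb)//.
  by rewrite /delayed_iter iterS /delayed_step min_l.
(* As J is positive, the solution is itself in the range of [delayed_step], which gives a bound and
   a modulus of continuity beyond b as well. *)
case: (J) J0 => // j _; exists (delayed_iter d j x) => //.
exact: delayed_iter_continuous.
Qed.

(** The alternative u t0 = c or x = kappa is written as a vanishing product because this form passes
    to the limit as d tends to 0. The approximations are equicontinuous since the increments of
    [intg (Phi v) a] are dominated by those of [intg h a]. *)
Lemma tonelli_shooting : exists (x : R) (u : R -> R),
  [/\ 0 <= x <= kappa, (u t0 <= c /\ (u t0 - c) * (x - kappa) = 0),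
      continuous u, (forall t, t <= a -> u t = x) &
      (forall t, a <= t <= b -> u t = x + intg (Phi u) a t)].
Proof.
pose d n : R := n.+1%:R^-1.
have d0 n : 0 < d n by rewrite invr_gt0.
have dl : d n @[n --> \oo] --> (0 : R) by exact: cvg_harmonic.
have /choice[x_ /choice[u_ Hu]] := fun n => delayed_solution (d0 n).
have cu n : continuous (u_ n) by have [] := Hu n.
have [||phi [u [cu' phij uu]]] := locally_uniform_subsequence cu.
- move=> N; exists (kappa + intg h a b), 0%N => n _ s _.
  have [/andP[x0 xk] _ _ _ [_ [v cv ->]]] := Hu n.
  rewrite (le_trans (ler_normD _ _))// lerD//; first by rewrite ger0_norm.
  rewrite (le_trans (norm_intg_Phi _ _ cv))//; apply: intg_h_nd.
  by rewrite lerBlDr ge_min lerDl (ltW (d0 n)) orbT.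
- move=> N e e0.
  have ch := @continuous_intg R h a h_Lloc.
  (* The time [Num.min s b - d n] may leave [-N, N], but it stays between this lower end and b, as
     [d n <= 1]. *)
  have [r r0 Hr] := unif_continuous_itv (- (`|N| + `|b| + 1)) b ch e0.
  exists r => //; exists 0%N => n _ s t.
  wlog st : s t / s <= t.
    by move=> W sN tN; have [/W|/ltW /W] := leP s t; [exact|rewrite distrC [`|u_ n s - _|]distrC; exact].
  move=> sN tN str; have [_ _ _ _ [_ [v cv ->]]] := Hu n.
  rewrite /delayed_step opprD addrACA subrr add0r distrC.
  set z := Num.min s b - d n; set w := Num.min t b - d n.
  have zw : z <= w by rewrite lerB// le_min !ge_min st lexx orbT.
  have wz : w - z <= t - s.
    by rewrite /w /z; case: (leP s b) => sb; case: (leP t b) => tb; lra.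
  have wb : w <= b by rewrite lerBlDr ge_min lerDl (ltW (d0 n)) orbT.
  have zN : - (`|N| + `|b| + 1) <= z.
    have d1 : d n <= 1 by rewrite invf_le1 ?ltr0n// ler1n.
    have sN' : - `|N| <= s.
      by move: sN => /andP[sN _]; rewrite (le_trans _ sN)// lerN2 ler_norm.
    have bN : - `|b| <= b by rewrite lerNl ler_normr lexx orbT.
    have n1 := normr_ge0 N; have n2 := normr_ge0 b.
    by rewrite /z lerBrDr le_min; apply/andP; split; lra.
  rewrite (le_lt_trans (intg_PhiB cv zw))// (le_lt_trans (ler_norm _))// distrC.
  apply: Hr.
  - by rewrite zN (le_trans zw).
  - by rewrite (le_trans zN).
  - rewrite distrC ger0_norm ?subr_ge0// (le_lt_trans wz)// (le_lt_trans _ str)//.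
    by rewrite distrC ler_norm.
have pw s := @locally_uniform_cvg_pointwise R _ _ s uu.
have dphi : (d \o phi) n @[n --> \oo] --> (0 : R).
  have /cvgrPdist_lt D := dl; apply/cvgrPdist_lt => e e0; have [n0 _ Hn0] := D e e0.
  by exists n0 => // n /= nn; apply: Hn0 => /=; exact: leq_trans (phij n).
have xE n : x_ (phi n) = u_ (phi n) a by have [_ _ _ ->] := Hu (phi n).
have xl : (x_ \o phi) n @[n --> \oo] --> u a.
  by rewrite (_ : x_ \o phi = fun n => u_ (phi n) a); [exact: pw|apply/funext => n; exact: xE].
exists (u a), u; split => //.
- have x0 n : 0 <= (x_ \o phi) n <= kappa by have [] := Hu (phi n).
  apply/andP; split.
    by apply: (ler_cvg_to (cvg_cst 0) xl); apply: nearW => n; have /andP[] := x0 n.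
  by apply: (ler_cvg_to xl (cvg_cst kappa)); apply: nearW => n; have /andP[] := x0 n.
- split.
    by apply: (ler_cvg_to (pw t0) (cvg_cst c)); apply: nearW => n; have [_ []] := Hu (phi n).
  have A : (u_ (phi n) t0 - c) * ((x_ \o phi) n - kappa) @[n --> \oo] -->
      (u t0 - c) * (u a - kappa).
    by apply: cvgM; apply: cvgB => //; [exact: pw|exact: cvg_cst|exact: cvg_cst].
  have E : (fun n => (u_ (phi n) t0 - c) * ((x_ \o phi) n - kappa)) = fun=> 0.
    by apply/funext => n; have [_ []] := Hu (phi n).
  by rewrite E in A; apply: (cvg_unique _ A (cvg_cst 0)); exact: Rhausdorff.
- move=> t ta; apply: (cvg_unique (@Rhausdorff R) (pw t)).
  rewrite (_ : (fun n => _) = (x_ \o phi)); first exact: xl.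
  by apply/funext => n /=; have [_ _ _ ->] := Hu (phi n).
- move=> t /andP[at_ tb].
  have I1 := @L1_continuous_cvg R _ _ _ a t Phi_L1 Phi_Lloc cu' (fun n => cu (phi n)) uu.
  (* The integral over the last stretch, of length d, is dominated by that of h; as it tends to 0,
     the delay disappears from the equation. *)
  have I2 : intg h a t - intg h a (t - (d \o phi) n) @[n --> \oo] --> (0 : R).
    rewrite -[X in _ --> X](subrr (intg h a t)); apply: cvgB; first exact: cvg_cst.
    have A : t - (d \o phi) n @[n --> \oo] --> t.
      by rewrite -[X in _ --> X]subr0; apply: cvgB => //; exact: cvg_cst.
    exact: cvg_comp A (@continuous_intg R h a h_Lloc t).
  have I3 : intg (Phi (u_ (phi n))) a t - intg (Phi (u_ (phi n))) a (t - (d \o phi) n)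
      @[n --> \oo] --> (0 : R).
    apply/cvgr0Pnorm_lt => e e0; move/cvgr0Pnorm_lt : I2 => /(_ e e0); apply: filterS => n.
    apply: le_lt_trans; rewrite (le_trans _ (ler_norm _))//.
    by apply: intg_PhiB => //; rewrite gerBl ltW// d0.
  apply: (cvg_unique (@Rhausdorff R) (pw t)).
  have I4 := cvgB (cvgD xl I1) I3; rewrite subr0 in I4.
  have E : (fun n => (u_ \o phi) n t) = (x_ \o phi) + (fun n => intg (Phi (u_ (phi n))) a t) -
      (fun n => intg (Phi (u_ (phi n))) a t - intg (Phi (u_ (phi n))) a (t - (d \o phi) n)).
    apply/funext => n; rewrite !fctE /=.
    by have [_ _ _ _ [Ht _]] := Hu (phi n); rewrite Ht//=; ring.
  by rewrite E; exact: I4.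
Qed.

End tonelli.

(** * A priori estimates *)

Section continuous_min_max.
Variable R : realType.
Implicit Types u v : R -> R.

Lemma continuous_max_fun u v : continuous u -> continuous v ->
  continuous (fun s => Num.max (u s) (v s)).
Proof. by move=> cu cv s; have := continuous_max (cu s) (cv s). Qed.

Lemma continuous_min_fun u v : continuous u -> continuous v ->
  continuous (fun s => Num.min (u s) (v s)).
Proof. by move=> cu cv s; have := continuous_min (cu s) (cv s). Qed.

End continuous_min_max.

(** * Comparison for positive linear Volterra operators *)

Section operator_estimates.
Variable R : realType.
Implicit Types (T : (R -> R) -> R -> R) (u v w g : R -> R) (a b s t zeta tau : R).
Local Notation mu := (@lebesgue_measure R).

(** Stopping u at zeta turns bounds on ]-oo, zeta] into bounds on R, as the hypotheses on the
    operators ask; a Volterra operator sees no difference up to zeta. *)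
Definition freeze zeta u s := u (Num.min s zeta).

Lemma freeze_continuous zeta u : continuous u -> continuous (freeze zeta u).
Proof.
move=> cu s; apply: (@continuous_comp _ _ _ (fun s => Num.min s zeta) u); last exact: cu.
by apply: continuous_min; [exact: cvg_id|exact: cvg_cst].
Qed.

Lemma freezeE zeta u s : s <= zeta -> freeze zeta u s = u s.
Proof. by move=> sz; rewrite /freeze min_l. Qed.

Lemma freezeP zeta u (P : R -> Prop) : (forall s, s <= zeta -> P (u s)) ->
  forall s, P (freeze zeta u s).
Proof. by move=> H s; apply: H; rewrite ge_min lexx orbT. Qed.

Lemma Volterra_freeze T zeta u : Volterra T -> continuous u ->
  {ae mu, forall t, t <= zeta -> T (freeze zeta u) t = T u t}.
Proof.
move=> /(_ zeta)[_ H] cu; apply: (H zeta) => //; first exact: freeze_continuous.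
by move=> s sz; exact: freezeE.
Qed.

Lemma const_continuous (k : R) : continuous (fun _ : R => k).
Proof. by move=> ?; exact: cvg_cst. Qed.
Local Hint Resolve const_continuous : core.

Lemma linear_operator0 T : linear_operator T -> {ae mu, forall t, T (fun=> 0) t = 0}.
Proof.
move=> /(_ (-1) (fun=> 0) (fun=> 0))H; have := H (@const_continuous 0) (@const_continuous 0).
rewrite (_ : (fun _ : R => -1 * 0 + 0) = fun=> 0); last by apply/funext => ?; rewrite mulr0 addr0.
by move=> /aeS; apply => t ->; rewrite mulN1r addNr.
Qed.

Lemma linear_operatorZ T (k : R) u : linear_operator T -> continuous u ->
  {ae mu, forall t, T (fun s => k * u s) t = k * T u t}.
Proof.
move=> lT cu; have := lT k u (fun=> 0) cu (@const_continuous 0).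
rewrite (_ : (fun s => k * u s + 0) = (fun s => k * u s)); last by apply/funext => ?; rewrite addr0.
by move=> H; apply: (aeS (aeI H (linear_operator0 lT))) => t [-> ->]; rewrite addr0.
Qed.

Lemma linear_operatorB T u v : linear_operator T -> continuous u -> continuous v ->
  {ae mu, forall t, T (fun s => u s - v s) t = T u t - T v t}.
Proof.
move=> lT cu cv; have := lT (-1) v u cv cu.
rewrite (_ : (fun s => -1 * v s + u s) = (fun s => u s - v s)).
  by move=> /aeS; apply => t ->; rewrite mulN1r addrC.
by apply/funext => ?; rewrite mulN1r addrC.
Qed.

(** Positivity concerns functions that are nonnegative on all of R; it applies to v - u frozen at
    zeta. *)
Lemma positive_Volterra_le T zeta u v : linear_operator T -> positive_operator T ->
  Volterra T -> continuous u -> continuous v -> (forall s, s <= zeta -> u s <= v s) ->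
  {ae mu, forall t, t <= zeta -> T u t <= T v t}.
Proof.
move=> lT pT VT cu cv uv.
have cw : continuous (fun s => v s - u s) by move=> s; apply: cvgB; [exact: cv|exact: cu].
have := pT _ (@freeze_continuous zeta _ cw); rewrite /= => H.
have {}H : {ae mu, forall t, 0 <= T (freeze zeta (fun s => v s - u s)) t}.
  by apply: H; apply: (@freezeP _ _ (fun x => 0 <= x)) => s sz; rewrite subr_ge0 uv.
apply: (aeS (aeI H (aeI (Volterra_freeze zeta VT cw) (linear_operatorB lT cv cu)))) => t.
by move=> [A [B C]] tz; rewrite -subr_ge0 -C -B.
Qed.

(* The exceptional null set depends on zeta: use rational zeta and let zeta
   decrease to t. *)
Lemma positive_Volterra_le_mul T (beta : R -> R) tau w g :
  linear_operator T -> positive_operator T -> Volterra T ->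
  continuous w -> continuous g -> continuous beta ->
  (forall zeta s, zeta <= tau -> s <= zeta -> w s <= beta zeta * g s) ->
  {ae mu, forall t, t <= tau -> T w t <= beta t * T g t}.
Proof.
move=> lT pT VT cw cg cb H.
have Hq (q : rat) : {ae mu, forall t, ratr q <= tau -> t <= ratr q ->
    T w t <= beta (ratr q) * T g t}.
  have [qtau|qtau] := boolP (ratr q <= tau); last by apply: aeW => t.
  have cbg : continuous (fun s => beta (ratr q) * g s).
    by move=> s; apply: cvgM; [exact: cvg_cst|exact: cg].
  have A := positive_Volterra_le lT pT VT cw cbg (fun s => H _ s qtau).
  apply: (aeS (aeI A (linear_operatorZ (beta (ratr q)) lT cg))) => t [B C] _ tq.
  by rewrite -C B.
have Hn (n : nat) : {ae mu, forall t, if unpickle n is Some q then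
    (ratr q <= tau -> t <= ratr q -> T w t <= beta (ratr q) * T g t) else True}.
  by case: (unpickle n) => [q|]; [exact: Hq|exact: aeW].
(* Discarding t = tau leaves room for a rational between t and tau. *)
apply: (aeS (aeI (ae_foralln Hn) (ae_neq tau))) => t [A /eqP tneq] tle.
have ttau : t < tau by rewrite lt_neqAle tneq.
rewrite leNgt; apply/negP => lt_w.
have cbt : (fun r => beta r * T g t) @ t --> beta t * T g t.
  by apply: cvgM; [exact: cb|exact: cvg_cst].
have /nbhs_ballP[r /= r0 Hr] : \forall r \near t, beta r * T g t < T w t.
  exact: (@cvgr_lt _ _ _ _ _ _ cbt).
have tm : t < Num.min tau (t + r) by rewrite lt_min ttau ltrDl.
have [q] := rat_in_itvoo tm.
rewrite in_itv/= lt_min => /andP[tq /andP[qtau qr]].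
have := A (pickle q); rewrite pickleK => /(_ (ltW qtau) (ltW tq)).
rewrite leNgt => /negP; apply; apply: Hr.
by rewrite /ball/= distrC ger0_norm ?subr_ge0 ?(ltW tq)// ltrBlDl.
Qed.

Lemma L1_continuousD T T' : (forall u, continuous u -> Lloc [set: R] (T u)) ->
  (forall u, continuous u -> Lloc [set: R] (T' u)) ->
  L1_continuous T -> L1_continuous T' -> L1_continuous (fun u t => T u t + T' u t).
Proof.
move=> LT LT' cT cT' u cu a b e e0; have e2 : 0 < e / 2 by rewrite divr_gt0.
have [N [d [d0 Hd]]] := cT u cu a b _ e2; have [N' [d' [d'0 Hd']]] := cT' u cu a b _ e2.
exists (Num.max N N'), (Num.min d d'); split; first by rewrite lt_min d0.
move=> v cv Hv.
have A : intg (fun t => `|T v t - T u t|) a b < e / 2.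
  apply: Hd => // s /andP[s1 s2]; have := Hv s; rewrite lt_min => /(_ _)/andP[]//.
  by rewrite le_max s2 andbT (le_trans _ s1)// lerN2 le_max lexx.
have B : intg (fun t => `|T' v t - T' u t|) a b < e / 2.
  apply: Hd' => // s /andP[s1 s2]; have := Hv s; rewrite lt_min => /(_ _)/andP[]//.
  by rewrite le_max s2 orbT andbT (le_trans _ s1)// lerN2 le_max lexx orbT.
have LA := Lloc_norm (LlocB (LT _ cv) (LT _ cu)).
have LB := Lloc_norm (LlocB (LT' _ cv) (LT' _ cu)).
rewrite [e]splitr; apply: le_lt_trans (ltrD A B); rewrite -intgD//.
apply: le_intg; last by apply: aeW => t _ /=; rewrite opprD addrACA ler_normD.
  exact: (Lloc_norm (LlocB (LlocD (LT _ cv) (LT' _ cv)) (LlocD (LT _ cu) (LT' _ cu)))).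
exact: LlocD.
Qed.

Lemma L1_continuousN T : L1_continuous T -> L1_continuous (fun u t => - T u t).
Proof.
move=> cT u cu a b e e0; have [N [d [d0 Hd]]] := cT u cu a b _ e0.
exists N, d; split => // v cv Hv; apply: le_lt_trans (Hd v cv Hv).
rewrite le_eqVlt; apply/orP; left; apply/eqP; congr intg.
by apply/funext => t; rewrite -opprD normrN.
Qed.

Lemma L1_continuous_comp T (chi : (R -> R) -> R -> R) :
  (forall u, continuous u -> continuous (chi u)) ->
  (forall u v s, `|chi u s - chi v s| <= `|u s - v s|) ->
  L1_continuous T -> L1_continuous (T \o chi).
Proof.
move=> cchi Hchi cT u cu a b e e0; have [N [d [d0 Hd]]] := cT _ (cchi u cu) a b _ e0.
exists N, d; split => // v cv Hv; apply: Hd; first exact: cchi.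
by move=> s sN; apply: le_lt_trans (Hchi _ _ _) (Hv s sN).
Qed.

Lemma Volterra_continuous T : Volterra T -> continuous_operator T.
Proof. by move=> /(_ 0)[]. Qed.

Lemma Volterra_Lloc T u : Volterra T -> continuous u -> Lloc [set: R] (T u).
Proof. by move=> /Volterra_continuous[H _]; exact: H. Qed.

End operator_estimates.

(** * Integrable majorants from the growth function q *)

Section Caratheodory_majorant.
Variable R : realType.
Local Notation mu := (@lebesgue_measure R).

(** Measurability does not enter: the integral of a nonnegative function is a supremum over the
    simple functions below it. This allows q(., x), which is only almost everywhere equal to a Borel
    function. *)
Lemma ge0_subfun_integral (D : set R) (f g : R -> \bar R) :
  (forall x, D x -> (0 <= f x)%E) -> (forall x, D x -> (f x <= g x)%E) ->
  (\int[mu]_(x in D) f x <= \int[mu]_(x in D) g x)%E.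
Proof.
move=> f0 fg; rewrite !ge0_integralE//; last by move=> x Dx; exact: le_trans (f0 x Dx) (fg x Dx).
apply: le_ereal_sup => _ [h Hh <-]; exists h => // x.
by apply: le_trans (Hh x) _; rewrite !patchE; case: ifP => //; rewrite inE => /fg.
Qed.

(** By monotonicity q(t, x) is the supremum of q(t, .) over [0, x], hence equals an integrable Borel
    function off a null set N. Setting the latter to 0 on N and outside [t0, b] gives a g that also
    lies below q(., x) on [t0, b], whence the bound on its integral. *)
Lemma Kloc_majorant (t0 : R) (q : R -> R -> R) (b x : R) : Kloc t0 q ->
  (forall t x y : R, t0 <= t -> 0 <= x -> x <= y -> q t x <= q t y) ->
  0 <= x -> exists g : R -> R, [/\ Lloc [set: R] g, (forall t, 0 <= g t),
    {ae mu, forall t, t0 <= t <= b -> q t x <= g t} &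
    ((intg g t0 b)%:E <= \int[mu]_(s in `[t0, b]) (q s x)%:E)%E].
Proof.
move=> [q0 _ _ /(_ `[0, x]%classic)] + qnd x0.
have sub : `[0, x]%classic `<=` `[0, +oo[%classic by apply: subset_itvl.
move=> /(_ sub (@segment_compact _ _ _) t0 b).
have sub2 : `[t0, b]%classic `<=` `[t0, +oo[%classic by apply: subset_itvl.
move=> /(_ sub2)[g0 ig0 [N [mN N0 HN]]].
have supE t : t0 <= t -> sup (q t @` `[0, x]%classic) = q t x.
  move=> tt; have ub : ubound (q t @` `[0, x]%classic) (q t x).
    by move=> _ [y /= + <-]; rewrite in_itv/= => /andP[y0 yx]; apply: qnd.
  have mx : (q t @` `[0, x]%classic) (q t x) by exists x => //=; rewrite in_itv/= x0 lexx.
  apply/eqP; rewrite eq_le ge_sup//=; last by exists (q t x).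
  by apply: sup_upper_bound => //; split; [exists (q t x)|exists (q t x)].
have gE t : t0 <= t <= b -> ~ N t -> q t x = g0 t.
  move=> tb nNt; have : ~ ~ (`[t0, b]%classic t -> sup (q t @` `[0, x]%classic) = g0 t).
    by move=> /HN.
  have /andP[tt _] := tb.
  by move=> /contrapT; rewrite supE//; apply; rewrite /= in_itv.
pose D := `[t0, b]%classic `\` N.
have mD : measurable (D : set (measurableTypeR R)) by exact: measurableD.
pose g := g0 \_ D.
have Dsub : D `<=` `[t0, b]%classic by exact: subDsetl.
have iD : mu.-integrable D (EFin \o g0) by apply: integrableS ig0.
have ig : mu.-integrable [set: R] (EFin \o g).
  have := (integrable_mkcond (mu := mu) (EFin \o g0) mD).1 iD.
  by rewrite restrict_EFin.
have gD t : D t -> g t = q t x.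
  by move=> [/=]; rewrite in_itv/= => tb nN; rewrite /g patchE mem_set//= gE.
have gD0 t : ~ D t -> g t = 0 by move=> nD; rewrite /g patchE memNset.
have g_ge0 t : 0 <= g t.
  have [Dt|/gD0->//] := pselect (D t); rewrite gD//; apply: q0 => //.
  by have := Dsub _ Dt; rewrite /= in_itv/= => /andP[].
exists g; split => //.
- by apply/LlocT => a c; apply: integrableS ig.
- exists N; split => // t /=; apply: contra_notP => nN tb.
  by rewrite gD//; split => //; rewrite /= in_itv.
- have Lg : mu.-integrable `[t0, b] (EFin \o g) by apply: integrableS ig.
  rewrite /intg /Rintegral fineK; last exact: integrable_fin_num.
  apply: ge0_subfun_integral => t /=; first by rewrite lee_fin.
  rewrite in_itv/= lee_fin => tb.
  have [Dt|/gD0->] := pselect (D t); first by rewrite gD.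
  by apply: q0 => //; case/andP: tb.
Qed.

Lemma Kloc_sublinear (t0 : R) (q : R -> R -> R) (b A K : R) : Kloc t0 q ->
  (forall t x y : R, t0 <= t -> 0 <= x -> x <= y -> q t x <= q t y) ->
  (forall b : R, t0 < b ->
     ((x^-1)%:E * \int[mu]_(s in `[t0, b]) (q s x)%:E)%E @[x --> +oo] --> 0%E) ->
  t0 < b -> 0 < A -> 0 <= K ->
  exists (rho : R) (g : R -> R), [/\ 0 < rho, Lloc [set: R] g, (forall t, 0 <= g t),
    {ae mu, forall t, t0 <= t <= b -> q t rho <= g t} &
    A * (K + intg g t0 b) <= rho].
Proof.
move=> Kq qnd qlim tb A0 K0; have := qlim b tb.
have e0 : 0 < (2 * A)^-1 by rewrite invr_gt0 mulr_gt0.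
move=> /(_ [set x | (x < (2 * A)^-1%:E)%E]) H.
have : nbhs (0%E : \bar R) [set x | (x < (2 * A)^-1%:E)%E].
  by apply: open_nbhs_nbhs; split; [exact: open_ereal_lt_ereal|rewrite /= lte_fin].
move=> /H [M [Mr HM]].
(* Above M the integral of q(., rho) is below rho / (2 A), and rho is at least 2 A K: both terms of
   A (K + integral of g) are then at most rho / 2. *)
pose rho := Num.max (M + 1) (Num.max 1 (2 * A * K)).
have rM : M < rho by rewrite lt_max ltrDl ltr01.
have r1 : 1 <= rho by rewrite !le_max lexx orbT.
have rK : 2 * A * K <= rho by rewrite !le_max lexx !orbT.
have r0 : 0 < rho by exact: lt_le_trans r1.
have [g [Lg g0 qg ig]] := Kloc_majorant b Kq qnd (ltW r0).
exists rho, g; split => //.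
have /= := HM rho rM; move: ig.
set J := (\int[mu]_(s in _) _)%E => ig HJ.
have : (rho^-1%:E * (intg g t0 b)%:E < (2 * A)^-1%:E)%E.
  by apply: le_lt_trans HJ; apply: lee_wpmul2l => //; rewrite lee_fin invr_ge0 ltW.
rewrite -EFinM lte_fin mulrC ltr_pdivrMr// -ltr_pdivrMl ?invr_gt0 ?mulr_gt0// invrK => H2.
have : A * intg g t0 b < rho / 2 by rewrite ltr_pdivlMr// mulrC mulrA.
lra.
Qed.

End Caratheodory_majorant.

(** * Monotone quotient u / gamma and the lower bound for u t0 *)

Section estimates.
Variable R : realType.
Local Notation mu := (@lebesgue_measure R).
Implicit Types (u v w : R -> R) (a b s t : R).

Lemma ACloc_continuous (g : R -> R) (D : set R) : ACloc [set: R] D g -> continuous g.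
Proof.
move=> [_ H] x; apply/cvgrPdist_lt => e e0.
have [d d0 Hd] := abs_continuous_continuous x (H (x - 1) (x + 1) (@subsetT _ _)) e0.
exists (Num.min d 1); first by rewrite /= lt_min d0 ltr01.
move=> z; rewrite /ball_/= lt_min => /andP[zd z1].
have [zx|/ltW zx] := leP z x.
  apply: Hd => //; last by apply: le_lt_trans zd; exact: ler_norm.
    by rewrite lerBlDr -lerBlDl (le_trans (ler_norm _))// ltW.
  by rewrite lerDl.
rewrite distrC; apply: Hd => //; first by rewrite gerBl.
  by rewrite -lerBlDl (le_trans (ler_norm _))// distrC ltW.
by rewrite distrC in zd; apply: le_lt_trans zd; exact: ler_norm.
Qed.

Variables (ell1 : (R -> R) -> R -> R) (gamma : R -> R).
Hypothesis ell1_lin : linear_operator ell1.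
Hypothesis ell1_pos : positive_operator ell1.
Hypothesis ell1_V : Volterra ell1.
Hypothesis gamma_AC : ACloc [set: R] `]0, +oo[ gamma.
Hypothesis gamma_der : {ae mu, forall t, derive1 gamma t <= - ell1 gamma t}.

Lemma gamma_gt0 t : 0 < gamma t.
Proof. by have [/(_ t I)] := gamma_AC; rewrite /= in_itv/= andbT. Qed.

Lemma gamma_continuous : continuous gamma.
Proof. exact: ACloc_continuous gamma_AC. Qed.

Lemma ell1_gamma_ge0 : {ae mu, forall t, 0 <= ell1 gamma t}.
Proof.
by apply: ell1_pos => [|s]; [exact: gamma_continuous|exact: ltW (gamma_gt0 s)].
Qed.

Lemma ell1_gamma_Lloc : Lloc [set: R] (ell1 gamma).
Proof. exact: Volterra_Lloc ell1_V gamma_continuous. Qed.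

Lemma gamma_decrement s t : s <= t -> gamma t - gamma s <= - intg (ell1 gamma) s t.
Proof.
move=> st; rewrite -intgN; last exact: ell1_gamma_Lloc.
apply: abs_continuous_le => //; last exact: LlocN ell1_gamma_Lloc.
by split => //; have [] := gamma_AC.
Qed.

Lemma gamma_nonincreasing s t : s <= t -> gamma t <= gamma s.
Proof.
move=> st; have := gamma_decrement st.
have : 0 <= intg (ell1 gamma) s t.
  by apply: intg_ge0; [exact: ell1_gamma_Lloc|apply: (aeS ell1_gamma_ge0)].
lra.
Qed.

(* Let lambda be the maximum of u / gamma on ]-oo, t], attained at r. Then
   w = lambda gamma - u satisfies w' <= - ell1 (lambda gamma - v) <= 0 after r
   and w r = 0, hence w t <= 0: the maximum is also attained at t. *)
Lemma quotient_nondecreasing u v (Psi : R -> R) (x : R) a b :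
  continuous u -> continuous v -> Lloc [set: R] Psi ->
  0 <= x -> (forall s, s <= a -> u s = x) ->
  (forall s, s <= b -> v s <= Num.max (u s) 0) ->
  (forall s t, a <= s -> s <= t -> t <= b -> u t - u s = intg Psi s t) ->
  {ae mu, forall t, a <= t <= b -> - ell1 v t <= Psi t} ->
  forall s t, s <= t -> t <= b -> u s * gamma t <= u t * gamma s.
Proof.
move=> cu cv LPsi x0 ux vu uE Psi_ge s t st tb.
have [ta|at_] := leP t a.
  rewrite !ux//; last exact: le_trans ta.
  by rewrite ler_wpM2l// gamma_nonincreasing.
have cq : continuous (fun r => u r / gamma r).
  move=> r; apply: cvgM; first exact: cu.
  by apply: cvgV; [rewrite gt_eqF// gamma_gt0|exact: gamma_continuous].
have [m + Hm] := EVT_max (ltW at_) (continuous_subspaceT cq).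
rewrite in_itv/= => /andP[am mt].
pose lambda := u m / gamma m.
have ua : u a = x by rewrite ux.
(* Before a, u is the constant x >= 0 and gamma is nonincreasing, so u / gamma is at most its value
   at a: the maximum over [a, t] bounds the quotient on the whole half-line. *)
have xl : x <= lambda * gamma a.
  by rewrite -ler_pdivrMr ?gamma_gt0// -ua; apply: Hm; rewrite in_itv/= lexx ltW.
have l0 : 0 <= lambda.
  by rewrite -(pmulr_lge0 _ (gamma_gt0 a)) (le_trans x0).
have ul r : r <= t -> u r <= lambda * gamma r.
  move=> rt; have [ra|ar] := leP r a.
    by rewrite ux// (le_trans xl)// ler_wpM2l// gamma_nonincreasing.
  by rewrite -ler_pdivrMr ?gamma_gt0//; apply: Hm; rewrite in_itv/= rt ltW.
have vl r : r <= t -> v r <= lambda * gamma r.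
  move=> rt; rewrite (le_trans (vu r (le_trans rt tb)))// ge_max ul//=.
  by rewrite mulr_ge0// ltW// gamma_gt0.
have cl : continuous (fun r => lambda * gamma r).
  by move=> r; apply: cvgM; [exact: cvg_cst|exact: gamma_continuous].
have A := positive_Volterra_le ell1_lin ell1_pos ell1_V cv cl vl.
have B := linear_operatorZ lambda ell1_lin gamma_continuous.
have L : Lloc [set: R] (fun r => - lambda * ell1 gamma r) by apply: LlocZ; exact: ell1_gamma_Lloc.
have : intg (fun r => - lambda * ell1 gamma r) m t <= intg Psi m t.
  apply: le_intg => //; apply: (aeS (aeI A (aeI B Psi_ge))) => r [Ar [Br Pr]] /andP[mr rt].
  rewrite (le_trans _ (Pr _)) ?(le_trans am)// ?(le_trans rt)//.
  by rewrite mulNr lerN2 -Br Ar.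
rewrite intgZ; last exact: ell1_gamma_Lloc.
rewrite -uE//; have := ler_wpM2l l0 (gamma_decrement mt).
have -> : u m = lambda * gamma m by rewrite divfK// gt_eqF// gamma_gt0.
move=> H1 H2; have tl : lambda * gamma t <= u t by lra.
rewrite -ler_pdivlMr ?gamma_gt0// mulrAC -ler_pdivrMr ?gamma_gt0//.
rewrite (@le_trans _ _ lambda)//; first by rewrite ler_pdivrMr ?gamma_gt0// ul.
by rewrite ler_pdivlMr ?gamma_gt0.
Qed.

Lemma integral_gronwall (p y : R -> R) a b : a <= b -> Lloc [set: R] p ->
  {ae mu, forall t, 0 <= p t} -> continuous y ->
  (forall t, a <= t <= b -> 0 <= y t) ->
  (forall s t, a <= s -> s <= t -> t <= b -> y s - y t <= intg (fun r => y r * p r) s t) ->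
  y a <= y b * expR (intg p a b).
Proof.
move=> ab Lp p0 cy y0 H.
have [m mab Hm] := EVT_max ab (continuous_subspaceT cy).
have yC t : a <= t <= b -> 0 <= y t <= y m.
  by move=> tab; rewrite y0//=; apply: Hm; rewrite in_itv.
have ndP s t : a <= s -> s <= t -> t <= b -> intg p a s <= intg p a t.
  move=> as_ st tb; apply: le_intg_itv => //; apply: (aeS p0) => //.
have G := @backward_gronwall R y (intg p a) a b (y m) ab (continuous_intg Lp) ndP yC.
have := G; rewrite (@intg_eq0 _ p a a)// expR0 mulr1; apply.
move=> s t c as_ st tb yc; rewrite -lerBlDl (le_trans (H s t as_ st tb))//.
have -> : intg p a t - intg p a s = intg p s t by rewrite (intg_cat Lp as_ st) addrC addKr.
rewrite -intgZ//; apply: le_intg; [exact: Lloc_continuousM|exact: LlocZ|].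
by apply: (aeS p0) => r pr /yc yrc; rewrite ler_wpM2r.
Qed.

Variables (ell0 : (R -> R) -> R -> R) (sigma : R -> R) (t0 kappa M : R).
Hypothesis ell0_lin : linear_operator ell0.
Hypothesis ell0_pos : positive_operator ell0.
Hypothesis ell0_V : Volterra ell0.
Hypothesis ell0_Vsigma : Volterra_delay_upto t0 sigma ell0.
Hypothesis kappa_gt0 : 0 < kappa.
Let p t := ell1 gamma t / gamma t.
Hypothesis ell0_gamma : {ae mu, forall t, t <= t0 -> p t <= ell0 (fun=> 1) t}.
Hypothesis M_bound : forall t, t <= t0 -> intg p (sigma t) t <= M.

Let p_ge0 : {ae mu, forall t, 0 <= p t}.
Proof.
by apply: (aeS ell1_gamma_ge0) => t H; rewrite divr_ge0// ltW// gamma_gt0.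
Qed.

Lemma gamma_ratio_Lloc : Lloc [set: R] p.
Proof.
have -> : p = (fun t => (gamma t)^-1 * ell1 gamma t) by apply/funext => t; rewrite mulrC.
apply: Lloc_continuousM; last exact: ell1_gamma_Lloc.
by move=> t; apply: cvgV; [rewrite gt_eqF// gamma_gt0|exact: gamma_continuous].
Qed.

Lemma delay_bound_ge0 : 0 <= M.
Proof.
apply: le_trans (M_bound (lexx t0)); apply: intg_ge0; first exact: gamma_ratio_Lloc.
exact: (aeS p_ge0).
Qed.

(* Otherwise u t1 < m := u ts e^-M at a minimum point t1 of u on [ts, t0]; let s be
   the last point before t1 with m <= u s. On [s, t1] the delay stays after ts, as
   u would otherwise be at least m, so ell0 v sees only values above nu and u
   cannot decrease. *)
Lemma past_lower_bound u v (Psi : R -> R) a :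
  continuous u -> continuous v -> Lloc [set: R] Psi ->
  (forall s, s <= t0 -> 0 <= u s) ->
  (forall s, s <= t0 -> v s = Num.min (u s) kappa) ->
  (forall s t, s <= t -> t <= t0 -> u s * gamma t <= u t * gamma s) ->
  (forall s t, a <= s -> s <= t -> t <= t0 -> u t - u s = intg Psi s t) ->
  {ae mu, forall t, a <= t <= t0 -> ell0 v t - ell1 v t <= Psi t} ->
  forall s, a <= s -> s <= t0 -> u s * expR (- M) <= u t0.
Proof.
move=> cu cv LPsi u0 vE uq uE Psi_ge ts ats tst.
have Lp := gamma_ratio_Lloc.
have v0 s : s <= t0 -> 0 <= v s by move=> st; rewrite vE// le_min u0//= ltW.
have vu s : s <= t0 -> v s <= u s by move=> st; rewrite vE// ge_min lexx.
have cvg_ : continuous (fun s => v s / gamma s).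
  move=> s; apply: cvgM; first exact: cv.
  by apply: cvgV; [rewrite gt_eqF// gamma_gt0|exact: gamma_continuous].
(* Both u / gamma and kappa / gamma are nondecreasing, hence so is v / gamma, their minimum; its
   value at zeta is the coefficient for the past of zeta. *)
have l1v : {ae mu, forall t, t <= t0 -> ell1 v t <= v t / gamma t * ell1 gamma t}.
  apply: positive_Volterra_le_mul => //; first exact: gamma_continuous.
  move=> zeta s zt sz; rewrite mulrAC ler_pdivlMr ?gamma_gt0// !vE ?(le_trans sz)//.
  have gz0 := ltW (gamma_gt0 zeta); have [uz|uz] := leP (u zeta) kappa.
    by rewrite (le_trans _ (uq s zeta sz zt))// ler_wpM2r// ge_min lexx.
  rewrite (@le_trans _ _ (kappa * gamma zeta))//.
    by rewrite ler_wpM2r// ge_min lexx orbT.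
  by rewrite ler_wpM2l ?(ltW kappa_gt0)// gamma_nonincreasing.
have l0v : {ae mu, forall t, t <= t0 -> 0 <= ell0 v t}.
  have A := positive_Volterra_le ell0_lin ell0_pos ell0_V (@const_continuous R 0) cv v0.
  by apply: (aeS (aeI A (linear_operator0 ell0_lin))) => t [B C] tt; rewrite -C B.
(* As ell0 v >= 0, the derivative of u is at least - ell1 v >= - v p >= - u p; going from s1 to s2,
   u keeps at least the fraction e^-(integral of p). *)
have step s1 s2 : a <= s1 -> s1 <= s2 -> s2 <= t0 -> u s1 <= u s2 * expR (intg p s1 s2).
  move=> as1 s12 s2t; apply: integral_gronwall => //.
    by move=> t /andP[_ ts2]; rewrite u0// (le_trans ts2).
  move=> s t s1s st ts2; rewrite -opprB uE ?(le_trans as1)//; last exact: le_trans s2t.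
  rewrite -intgN//; apply: le_intg; [exact: LlocN|exact: Lloc_continuousM|].
  apply: (aeS (aeI Psi_ge (aeI l1v (aeI l0v p_ge0)))) => r [A [B [C D]]] /andP[sr rt].
  have rt0 : r <= t0 by rewrite (le_trans rt)// (le_trans ts2).
  have := A; rewrite rt0 (le_trans as1) ?(le_trans s1s)// => /(_ isT) {}A.
  have {}B := B rt0; have {}C := C rt0.
  have E : v r / gamma r * ell1 gamma r = v r * p r by rewrite /p mulrAC mulrA.
  rewrite E in B; have := ler_wpM2r D (vu r rt0); rewrite /=; lra.
have [t1 + t1min] := EVT_min tst (continuous_subspaceT cu).
rewrite in_itv/= => /andP[tst1 t1t0].
have {}t1min r : ts <= r -> r <= t0 -> u t1 <= u r.
  by move=> h1 h2; apply: t1min; rewrite in_itv/= h1.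
apply: le_trans (t1min t0 tst (lexx _)); rewrite leNgt; apply/negP => t1m.
set m := u ts * expR (- M) in t1m.
have mts : m <= u ts.
  by rewrite ler_piMr ?u0// -expR0 ler_expR oppr_le0 delay_bound_ge0.
pose S := [set r | [/\ ts <= r, r <= t1 & m <= u r]].
have Sts : S ts by split.
have hS : has_sup S by split; [exists ts|exists t1 => r []].
pose s := sup S.
have tss : ts <= s by exact: sup_upper_bound.
have st1 : s <= t1 by apply: ge_sup; [exists ts|move=> r []].
have us : m <= u s.
  rewrite leNgt; apply/negP => usm.
  have /nbhs_ballP[e /= e0 He] : \forall r \near s, u r < m by exact: (@cvgr_lt _ _ _ _ _ _ (cu s)).
  have [r Sr sr] := sup_adherent e0 hS.
  have rs : r <= s by exact: sup_upper_bound.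
  have : u r < m by apply: He; rewrite /ball/= ger0_norm ?subr_ge0// ltrBlDl -ltrBlDr.
  by case: Sr => _ _; rewrite leNgt => /negP.
have after r : s < r -> r <= t1 -> u r < m.
  move=> sr rt1; rewrite ltNge; apply/negP => mr.
  have : r <= s by apply: sup_upper_bound => //; split => //; rewrite (le_trans tss)// ltW.
  by rewrite leNgt sr.
have delayed r : s < r -> r <= t1 -> ts < sigma r.
  move=> sr rt1; rewrite ltNge; apply/negP => sts.
  have := after r sr rt1; rewrite ltNge => /negP; apply.
  have tsr : ts <= r by rewrite (le_trans tss)// ltW.
  have rt0 : r <= t0 by exact: le_trans t1t0.
  rewrite /m expRN ler_pdivrMr ?expR_gt0//.
  apply: le_trans (step ts r ats tsr rt0) _.
  rewrite ler_wpM2l ?u0// ler_expR (le_trans _ (M_bound rt0))//.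
  by apply: le_intg_itv => //; exact: (aeS p_ge0).
(* On [ts, t0] v is at least nu, so [Num.max (v r) nu] agrees with v on the delay intervals used
   here while being at least nu on all of R. This yields ell0 v >= nu ell0(1) >= nu p. *)
pose nu := Num.min (u t1) kappa.
have cmax : continuous (fun r => Num.max (v r) nu).
  by apply: continuous_max_fun => // r; exact: cvg_cst.
have l0max : {ae mu, forall t, t <= t0 -> ell0 (fun=> nu * 1) t <= ell0 (fun r => Num.max (v r) nu) t}.
  by apply: positive_Volterra_le => // [r|r _]; [exact: cvg_cst|rewrite mulr1 le_max lexx orbT].
have l0nu := linear_operatorZ nu ell0_lin (@const_continuous R 1).
have l0eq := ell0_Vsigma.2 v _ cv cmax.
have nu0 : 0 <= nu by rewrite le_min u0//= ltW.
have lower : {ae mu, forall r, s < r -> r <= t1 -> (nu - v r) * p r <= Psi r}.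
  apply: (aeS (aeI Psi_ge (aeI l1v (aeI l0max (aeI l0nu (aeI l0eq ell0_gamma)))))).
  move=> r [A [B [C [D [E F]]]]] sr rt1.
  have rt0 : r <= t0 by exact: le_trans t1t0.
  have ar : a <= r by rewrite (le_trans ats)// (le_trans tss)// ltW.
  have {}A : ell0 v r - ell1 v r <= Psi r by apply: A; rewrite ar.
  have {}B := B rt0; have {}C := C rt0; have {}F := F rt0.
  have {}E : ell0 v r = ell0 (fun r => Num.max (v r) nu) r.
    apply: E => // z /andP[sz zr]; apply/esym/max_l.
    have zt0 : z <= t0 by exact: le_trans rt0.
    rewrite vE// le_min !ge_min lexx orbT andbT t1min//.
    by rewrite (le_trans _ sz)// ltW// delayed.
  have Bp : v r / gamma r * ell1 gamma r = v r * p r by rewrite /p mulrAC mulrA.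
  rewrite Bp in B; rewrite D in C.
  have := ler_wpM2l nu0 F; rewrite E in A; lra.
have cy : continuous (fun r => u r - u t1).
  by move=> r; apply: cvgB; [exact: cu|exact: cvg_cst].
(* The function y = u - u t1 is nonnegative, vanishes at t1 and decreases at rate at most y p,
   because capping at kappa gives v - nu <= u - u t1. Hence u s <= u t1 < m, against m <= u s. *)
have : u s - u t1 <= (u t1 - u t1) * expR (intg p s t1).
  apply: (@integral_gronwall p (fun r => u r - u t1)) => //.
    move=> r /andP[sr rt]; rewrite subr_ge0 t1min//; first exact: le_trans sr.
    exact: le_trans t1t0.
  move=> r r' sr rr r't1; have -> : u r - u t1 - (u r' - u t1) = - (u r' - u r) by ring.
  rewrite uE//; last 2 first.
  - by rewrite (le_trans ats)// (le_trans tss).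
  - by rewrite (le_trans r't1).
  rewrite -intgN//; apply: le_intg; [exact: LlocN|exact: Lloc_continuousM|].
  apply: (aeS (aeI lower (aeI p_ge0 (ae_neq s)))) => z [A [B /eqP C]] /andP[rz zr'].
  have sz : s < z by rewrite lt_neqAle eq_sym C (le_trans sr).
  have zt1 : z <= t1 by exact: le_trans r't1.
  have {}A := A sz zt1.
  have zt0 : z <= t0 by exact: le_trans t1t0.
  have tz : u t1 <= u z by rewrite t1min// (le_trans tss)// ltW.
  have K : v z - nu <= u z - u t1.
    by rewrite vE// /nu; case: (leP (u z) kappa); case: (leP (u t1) kappa); lra.
  have := ler_wpM2r B K; rewrite /=; lra.
rewrite subrr mul0r subr_le0 => ust1.
by have := le_lt_trans (le_trans us ust1) t1m; rewrite ltxx.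
Qed.

End estimates.

(** * Growth bound after t0 *)

Section growth.
Variable R : realType.
Local Notation mu := (@lebesgue_measure R).
Implicit Types (u v w g Psi : R -> R) (a b s t : R).

Variables (ell0 f : (R -> R) -> R -> R) (t0 kappa : R) (q : R -> R -> R).
Hypothesis ell0_lin : linear_operator ell0.
Hypothesis ell0_pos : positive_operator ell0.
Hypothesis ell0_V : Volterra ell0.
Hypothesis f_V : Volterra f.
Hypothesis kappa_gt0 : 0 < kappa.
Hypothesis q_nondecreasing : forall t x y : R,
  t0 <= t -> 0 <= x -> x <= y -> q t x <= q t y.
Hypothesis f_sgn : forall v, C0 [set: R] v ->
  0 <= v t0 <= kappa ->
  (forall t, t <= t0 -> - kappa <= v t <= kappa) ->
  {ae mu, forall t, t0 <= t -> f v t * Num.sg (v t) <= q t (supnorm v)}.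

Let L := intg (ell0 (fun=> 1)) t0.

(* After t0, L and g are nonnegative, so B' >= ell0(1) B + g and B t0 = K. *)
Definition supersolution K g t := expR (L t) * (K + intg g t0 t).

Lemma norm_le_bounded_fun u (C : R) : (forall s, `|u s| <= C) -> bounded_fun u.
Proof.
by move=> uC; exists C; split => [|x Cx y _]; [exact: num_real|apply: le_trans (uC y) (ltW Cx)].
Qed.

Let l1 : Lloc [set: R] (ell0 (fun=> 1)).
Proof. exact: Volterra_Lloc ell0_V (@const_continuous R 1). Qed.

Lemma ell0_one_ge0 : {ae mu, forall t, 0 <= ell0 (fun=> 1) t}.
Proof. by apply: ell0_pos => [|s]; [exact: const_continuous|exact: ler01]. Qed.

Lemma intg_nondecreasing g a s t : Lloc [set: R] g -> {ae mu, forall t, 0 <= g t} ->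
  s <= t -> intg g a s <= intg g a t.
Proof.
move=> Lg g0 st; have [sa|as_] := leP s a.
  by rewrite intg_eq0//; apply: intg_ge0 => //; apply: (aeS g0).
by apply: le_intg_itv => //; [apply: (aeS g0)|exact: ltW].
Qed.

Section supersolution_properties.
Variables (K : R) (g : R -> R).
Hypothesis K_gt0 : 0 < K.
Hypothesis Lg : Lloc [set: R] g.
Hypothesis g_ge0 : forall t, 0 <= g t.

Let B := supersolution K g.

Let L_nd s t : s <= t -> L s <= L t.
Proof. by apply: intg_nondecreasing => //; exact: ell0_one_ge0. Qed.

Let Q_nd s t : s <= t -> intg g t0 s <= intg g t0 t.
Proof. by apply: intg_nondecreasing => //; exact: aeW. Qed.

Let Q_ge0 t : 0 <= intg g t0 t.
Proof. by apply: intg_ge0 => //; exact: aeW. Qed.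

Lemma supersolution_left t : t <= t0 -> B t = K.
Proof. by move=> tt0; rewrite /B /supersolution /L !intg_eq0// expR0 mul1r addr0. Qed.

Lemma supersolution_continuous : continuous B.
Proof.
move=> t; apply: cvgM.
  by apply: (@continuous_comp _ _ _ L expR); [exact: continuous_intg|exact: continuous_expR].
by apply: cvgD; [exact: cvg_cst|exact: continuous_intg].
Qed.

Lemma supersolution_nondecreasing s t : s <= t -> B s <= B t.
Proof.
move=> st; apply: ler_pM => [|||]; first exact: expR_ge0.
- by rewrite addr_ge0// ltW.
- by rewrite ler_expR L_nd.
- by rewrite lerD2l Q_nd.
Qed.

Lemma supersolution_ge t : K <= B t.
Proof.
have [tt0|/ltW tt0] := leP t t0; first by rewrite supersolution_left.
by rewrite -(supersolution_left (lexx t0)) supersolution_nondecreasing.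
Qed.

(** The factor e^L grows at least like its tangent, and e^L >= 1 preserves the whole increment of
    the integral of g. *)
Lemma supersolution_increment s t : s <= t ->
  B s * (L t - L s) + (intg g t0 t - intg g t0 s) <= B t - B s.
Proof.
move=> st; rewrite /B /supersolution.
have E1 : 1 <= expR (L s).
  by rewrite -expR0 ler_expR; apply: intg_ge0 => //; apply: (aeS ell0_one_ge0).
have E2 : 1 + (L t - L s) <= expR (L t - L s) by exact: expR_ge1Dx.
have -> : expR (L t) = expR (L s) * expR (L t - L s) by rewrite -expRD addrC subrK.
have l0 : 0 <= L t - L s by rewrite subr_ge0 L_nd.
have q0 : 0 <= intg g t0 t - intg g t0 s by rewrite subr_ge0 Q_nd.
have qs := Q_ge0 s.
set E := expR (L s) in E1 *; set X := expR (L t - L s) in E2 *.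
set l := L t - L s in l0 E2 *; set Qs := intg g t0 s in q0 qs *; set Qt := intg g t0 t in q0 *.
have K0 := ltW K_gt0.
have KQ : 0 <= K + Qt by lra.
have E0 : 0 <= E by lra.
have H1 : E * (1 + l) * (K + Qt) <= E * X * (K + Qt).
  by rewrite ler_wpM2r// ler_wpM2l.
have H2 : Qt - Qs <= E * (Qt - Qs) by rewrite ler_peMl.
have H3 : E * l * (K + Qs) <= E * l * (K + Qt) by rewrite ler_wpM2l ?mulr_ge0//; lra.
lra.
Qed.

(** Over [s, t] the increment of u is at most B t (L t - L s) plus that of the integral of g, and
    the increment of B is at least B s (L t - L s) plus the same. So u - B grows by at most (B t - B
    s) (L t - L s), a quadratic error. The argument w of the operators is kept apart from u because
    it is the truncation of u in the construction of solutions. *)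
Lemma growth_bound u w Psi b rho : t0 <= b -> continuous w -> Lloc [set: R] Psi ->
  kappa <= K ->
  (forall s, s <= t0 -> 0 <= w s <= kappa) ->
  (forall s, t0 <= s <= b -> 0 < w s <= B s) ->
  B b <= rho -> {ae mu, forall t, t0 <= t <= b -> q t rho <= g t} ->
  (forall s t, t0 <= s -> s <= t -> t <= b -> u t - u s = intg Psi s t) ->
  {ae mu, forall t, t0 <= t <= b -> Psi t <= ell0 w t + f w t} ->
  u b - u t0 <= B b - B t0.
Proof.
move=> tb cw LPsi kK wleft wright Bb qg uE Psi_le.
have wB zeta s : zeta <= b -> s <= zeta -> w s <= B zeta * 1.
  move=> zb sz; rewrite mulr1; have [st|/ltW ts] := leP s t0.
    have /andP[_ wk] := wleft s st.
    by rewrite (le_trans wk)// (le_trans kK)// supersolution_ge.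
  have sb := le_trans sz zb; have := wright s; rewrite ts sb => /(_ isT) /andP[_ wBs].
  by rewrite (le_trans wBs)// supersolution_nondecreasing.
have l0w : {ae mu, forall t, t <= b -> ell0 w t <= B t * ell0 (fun=> 1) t}.
  by apply: positive_Volterra_le_mul => //; [exact: const_continuous|exact: supersolution_continuous].
(* (ii) is a statement on bounded functions: freezing at b keeps the supremum norm at most rho, and
   w > 0 on [t0, b] makes the sign equal to 1. *)
pose w' := freeze b w.
have cw' : continuous w' by exact: freeze_continuous.
have w'b s : `|w' s| <= rho.
  apply: (@freezeP _ b w (fun x => `|x| <= rho)) => r rb.
  rewrite (le_trans _ Bb)// ger0_norm; first by have := wB b r (lexx b) rb; rewrite mulr1.
  have [/wleft/andP[]//|/ltW tr] := leP r t0.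
  by have := wright r; rewrite tr rb => /(_ isT) /andP[/ltW].
have w't : w' t0 = w t0 by exact: freezeE.
have C0w' : C0 [set: R] w' by split => //; exact: norm_le_bounded_fun w'b.
have fw : {ae mu, forall t, t0 <= t <= b -> f w t <= g t}.
  have w'0 : 0 <= w' t0 <= kappa by rewrite w't wleft.
  have w'left t : t <= t0 -> - kappa <= w' t <= kappa.
    move=> tt0; rewrite /w' freezeE ?(le_trans tt0)//.
    by have /andP[w0 ->] := wleft t tt0; rewrite andbT (le_trans _ w0)// oppr_le0 ltW.
  have := f_sgn C0w' w'0 w'left => H.
  apply: (aeS (aeI H (aeI qg (Volterra_freeze b f_V cw)))) => t [A [C D]] /[dup] tt0b /andP[tt0 ttb].
  rewrite (le_trans _ (C tt0b))//.
  have := A tt0; rewrite /w' freezeE// D//.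
  have := wright t tt0b => /andP[wt0 _]; rewrite gtr0_sg// mulr1 => /le_trans; apply.
  apply: q_nondecreasing => //.
    apply: (@le_trans _ _ `|w' t|) => //; apply: sup_upper_bound; last by exists t.
    by split; [exists `|w' t|; exists t|exists rho => _ [s _ <-]; exact: w'b].
  by apply: ge_sup; [exists `|w' t|; exists t|move=> _ [s _ <-]; exact: w'b].
suff : u b - B b <= u t0 - B t0 by lra.
apply: (@nonincreasing_quadratic _ (fun t => u t - B t) B L) => //.
- exact: supersolution_continuous.
- by move=> s t _ + _; exact: L_nd.
move=> s t ts st ttb.
have tt0 := le_trans ts st.
have I : u t - u s <= B t * (L t - L s) + (intg g t0 t - intg g t0 s).
  have -> : L t - L s = intg (ell0 (fun=> 1)) s t by rewrite /L (intg_cat l1 ts st) addrC addKr.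
  have -> : intg g t0 t - intg g t0 s = intg g s t by rewrite (intg_cat Lg ts st) addrC addKr.
  rewrite uE// -intgZ// -intgD//; last exact: LlocZ.
  apply: le_intg => //; first by apply: LlocD => //; exact: LlocZ.
  apply: (aeS (aeI Psi_le (aeI l0w (aeI fw ell0_one_ge0)))) => r [A [C [D E]]] /andP[sr rt].
  have rb : r <= b by exact: le_trans ttb.
  have tr : t0 <= r by exact: le_trans sr.
  have {}A : Psi r <= ell0 w r + f w r by apply: A; rewrite tr.
  have {}D : f w r <= g r by apply: D; rewrite tr.
  have := ler_wpM2r E (supersolution_nondecreasing rt); have := C rb; rewrite /=; lra.
have J := supersolution_increment st.
have BB : 0 <= B t - B s by rewrite subr_ge0 supersolution_nondecreasing.
rewrite ger0_norm//; lra.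
Qed.

End supersolution_properties.
End growth.

(** * Existence *)

Section integral_solution.
Variable R : realType.
Local Notation mu := (@lebesgue_measure R).
Implicit Types (u v h : R -> R) (a b s t : R).

Lemma fine_lebesgue_measure_itv s t : s <= t -> t - s = fine (mu `[s, t]%classic).
Proof.
move=> st; rewrite lebesgue_measure_itv/= lte_fin.
case: ifPn => [//|]; rewrite -leNgt => ts.
by apply/eqP; rewrite subr_eq0 eq_le ts.
Qed.

(** Approximate h in the mean on [a, b] by a continuous g: over a family of intervals, the integral
    of |h| is at most that of |h - g| plus max |g| times the total length. *)
Lemma intg_abs_continuous u h a b : Lloc [set: R] h -> a <= b ->
  (forall s t, s <= t -> u t - u s = intg h s t) -> abs_continuous_on a b u.
Proof.
move=> Lh ab uE e e0; have e2 : 0 < e / 2 by rewrite divr_gt0.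
have mab : measurable (`[a, b]%classic : set (measurableTypeR R)) by [].
have fab : (mu `[a, b]%classic < +oo)%E by rewrite lebesgue_measure_itv/=; case: ifP => _; rewrite -?EFinB ltry.
have [g_ [cg _]] := approximation_continuous_integrable mab fab (Lloc_itv a b Lh).
move=> /(_ [set x | (x < (e / 2)%:E)%E]) H.
have : nbhs (0%E : \bar R) [set x | (x < (e / 2)%:E)%E].
  by apply: open_nbhs_nbhs; split; [exact: open_ereal_lt_ereal|rewrite /= lte_fin].
move=> /H [n _ /(_ n (leqnn n)) /= Hn].
set g := g_ n in Hn; have cgn : continuous g by exact: cg.
have Lg := Lloc_continuous cgn.
have Lw : Lloc [set: R] (fun t => `|h t - g t|) by exact: Lloc_norm (LlocB Lh Lg).
have [m _ Hm] := EVT_max ab (continuous_subspaceT (fun x => cvg_norm (cgn x))).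
have C0 : 0 < `|g m| + 1 by rewrite ltr_wpDl.
exists (e / 2 / (`|g m| + 1)); first by rewrite divr_gt0.
move=> k x y Hxy T; rewrite ltr_pdivlMr// => Hlen.
have wE : intg (fun t => `|h t - g t|) a b < e / 2.
  by rewrite -lte_fin /intg /Rintegral fineK//; apply: integrable_fin_num => //; exact: Lloc_itv.
have D : increments (intg (fun t => `|h t - g t|) a) x y <= intg (fun t => `|h t - g t|) a b.
  rewrite -[leRHS]subr0 -(@intg_eq0 _ (fun t => `|h t - g t|) a a)//.
  apply: increments_nondecreasing => // s t as_ st tb.
  by apply: le_intg_itv => //; exact: aeW.
apply: le_lt_trans (_ : _ <= intg (fun t => `|h t - g t|) a b +
    (\sum_(i < k) (y i - x i)) * (`|g m| + 1)) _; last by rewrite [e]splitr ltrD.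
apply: le_trans (lerD D (lexx _)); rewrite /increments mulr_suml -big_split/=.
apply: ler_sum => i _; have [ax xy yb] := Hxy i.
rewrite (intg_cat Lw ax xy) [X in _ <= X - _ + _]addrC addrK uE//.
apply: le_trans (norm_intg _ _ Lh) _.
have -> : (y i - x i) * (`|g m| + 1) = intg (fun=> `|g m| + 1) (x i) (y i).
  rewrite /intg Rintegral_cst// mulrC; congr (_ * _).
  exact: fine_lebesgue_measure_itv.
have Lc : Lloc [set: R] (fun=> `|g m| + 1) by apply: Lloc_continuous; exact: const_continuous.
rewrite -intgD//; apply: le_intg; [exact: Lloc_norm|exact: LlocD|].
apply: aeW => t /andP[xt ty] /=.
rewrite -{1}(subrK (g t) (h t)) (le_trans (ler_normD _ _))// lerD2l.
rewrite (@le_trans _ _ `|g m|) ?lerDl//; apply: Hm.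
by rewrite in_itv/= (le_trans ax)//= (le_trans ty).
Qed.

Lemma intg_ACloc u h : Lloc [set: R] h ->
  (forall s t, s <= t -> u t - u s = intg h s t) -> ACloc [set: R] [set: R] u.
Proof.
move=> Lh uE; split => // a b _; have [ab|ba] := leP a b; first exact: intg_abs_continuous uE.
move=> e e0; exists 1 => // n x y Hxy _ _; rewrite big1// => i _.
have [ax xy yb] := Hxy i; have := le_lt_trans (le_trans ax (le_trans xy yb)) ba.
by rewrite ltxx.
Qed.

Lemma intg_is_derive u h : Lloc [set: R] h ->
  (forall s t, s <= t -> u t - u s = intg h s t) ->
  {ae mu, forall t, is_derive t 1 u (h t)}.
Proof.
move=> Lh uE.
(* [derive_intg] concerns the points to the right of its base point; the base points - n reach every
   t. *)
have H (n : nat) := derive_intg (- n%:R) Lh.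
apply: (aeS (ae_foralln H)) => t Ht.
pose a : R := - (Num.bound `|t|)%:R.
have at_ : a < t.
  have := archi_boundP (normr_ge0 t); rewrite /a; have := ler_norm (- t); rewrite normrN.
  by move=> A B; rewrite ltrNl (le_lt_trans A).
have := is_deriveD (is_derive_cst (u a) t 1) (Ht (Num.bound `|t|) at_); rewrite add0r.
apply: near_eq_is_derive.
near=> z; have az : a <= z by apply: ltW; near: z; exact: lt_nbhsr.
have -> : u z = u a + intg h a z by rewrite -(uE a z az) addrC subrK.
by [].
Unshelve. all: by end_near. Qed.

End integral_solution.

(** * Solutions on bounded intervals and passage to the whole line *)

Section existence.
Variable R : realType.
Local Notation mu := (@lebesgue_measure R).
Implicit Types (u v w g : R -> R) (a b c s t : R).

Variables (ell0 ell1 f : (R -> R) -> R -> R) (t0 : R) (sigma : R -> R).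
Variables (kappa M : R) (q : R -> R -> R) (gamma : R -> R).
Hypothesis ell0_lin : linear_operator ell0.
Hypothesis ell0_pos : positive_operator ell0.
Hypothesis ell1_lin : linear_operator ell1.
Hypothesis ell1_pos : positive_operator ell1.
Hypothesis f_Car : local_Caratheodory f.
Hypothesis ell0_V : Volterra ell0.
Hypothesis ell1_V : Volterra ell1.
Hypothesis f_V : Volterra f.
Hypothesis ell0_Vsigma : Volterra_delay_upto t0 sigma ell0.
Hypothesis f0 : {ae mu, forall t, t <= t0 -> f (fun=> 0) t = 0}.
Hypothesis kappa_gt0 : 0 < kappa.
Hypothesis f_ge0 : forall v, C0 `[0, kappa] v -> {ae mu, forall t, t <= t0 -> 0 <= f v t}.
Hypothesis q_Kloc : Kloc t0 q.
Hypothesis q_nondecreasing : forall t x y : R,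
  t0 <= t -> 0 <= x -> x <= y -> q t x <= q t y.
Hypothesis q_lim : forall b, t0 < b ->
  ((x^-1)%:E * \int[mu]_(s in `[t0, b]) (q s x)%:E)%E @[x --> +oo] --> 0%E.
Hypothesis f_sgn : forall v, C0 [set: R] v ->
  0 <= v t0 <= kappa ->
  (forall t, t <= t0 -> - kappa <= v t <= kappa) ->
  {ae mu, forall t, t0 <= t -> f v t * Num.sg (v t) <= q t (supnorm v)}.
Hypothesis ell0f_ge0 : forall v, C0 `[0, +oo[ v ->
  (forall t, t <= t0 -> v t <= kappa) ->
  {ae mu, forall t, t0 <= t -> 0 <= ell0 v t + f v t}.
Hypothesis gamma_AC : ACloc [set: R] `]0, +oo[ gamma.
Hypothesis gamma_der : {ae mu, forall t, derive1 gamma t <= - ell1 gamma t}.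
Hypothesis ell0_gamma : {ae mu, forall t, t <= t0 ->
  ell1 gamma t / gamma t <= ell0 (fun=> 1) t}.
Hypothesis M_bound : forall t, t <= t0 ->
  intg (fun t => ell1 gamma t / gamma t) (sigma t) t <= M.

Definition rhs u t := ell0 u t - ell1 u t + f u t.

Lemma rhs_Lloc u : continuous u -> Lloc [set: R] (rhs u).
Proof.
move=> cu; apply: LlocD; last exact: Volterra_Lloc f_V cu.
by apply: LlocB; [exact: Volterra_Lloc ell0_V cu|exact: Volterra_Lloc ell1_V cu].
Qed.

Lemma rhs_L1 : L1_continuous rhs.
Proof.
have LN u : continuous u -> Lloc [set: R] (fun t => - ell1 u t).
  by move=> cu; apply: LlocN; exact: Volterra_Lloc ell1_V cu.
apply: L1_continuousD; [|by move=> u; exact: Volterra_Lloc f_V| |].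
- by move=> u cu; apply: LlocD; [exact: Volterra_Lloc ell0_V cu|exact: LN].
- apply: L1_continuousD => //; first by move=> u; exact: Volterra_Lloc ell0_V.
    exact/continuous_operator_L1/Volterra_continuous.
  exact/L1_continuousN/continuous_operator_L1/Volterra_continuous.
- exact/continuous_operator_L1/Volterra_continuous.
Qed.

Lemma rhs_Volterra zeta u v : continuous u -> continuous v ->
  (forall s, s <= zeta -> u s = v s) ->
  {ae mu, forall t, t <= zeta -> rhs u t = rhs v t}.
Proof.
move=> cu cv uv.
have A := (ell0_V zeta).2 zeta (lexx _) u v cu cv uv.
have B := (ell1_V zeta).2 zeta (lexx _) u v cu cv uv.
have C := (f_V zeta).2 zeta (lexx _) u v cu cv uv.
by apply: (aeS (aeI A (aeI B C))) => t [a1 [b1 c1]] tz; rewrite /rhs a1 ?b1 ?c1.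
Qed.

(** The majorant depends on rho only, not on u or zeta: it dominates the truncated equation, and
    later it gives the solutions on growing intervals a common modulus of continuity. *)
Lemma rhs_majorant rho : 0 < rho -> exists2 h : R -> R, Lloc [set: R] h &
  forall u zeta, continuous u -> (forall s, s <= zeta -> 0 <= u s <= rho) ->
    {ae mu, forall t, t <= zeta -> `|rhs u t| <= h t}.
Proof.
move=> rho0; have [qr [Lq q0 Hq]] := f_Car rho0.
have L0 := Volterra_Lloc ell0_V (@const_continuous R 1).
have L1 := Volterra_Lloc ell1_V (@const_continuous R 1).
exists (fun t => rho * ell0 (fun=> 1) t + rho * ell1 (fun=> 1) t + qr t).
  by apply: LlocD => //; apply: LlocD; exact: LlocZ.
move=> u zeta cu ub.
have bound T : linear_operator T -> positive_operator T -> Volterra T ->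
    {ae mu, forall t, t <= zeta -> 0 <= T u t <= rho * T (fun=> 1) t}.
  move=> lT pT VT.
  have A : {ae mu, forall t, t <= zeta -> T (fun=> 0) t <= T u t}.
    apply: positive_Volterra_le => //; first exact: const_continuous.
    by move=> s /ub /andP[].
  have B : {ae mu, forall t, t <= zeta -> T u t <= T (fun=> rho * 1) t}.
    apply: positive_Volterra_le => //; first exact: const_continuous.
    by move=> s /ub /andP[_]; rewrite mulr1.
  have C := linear_operatorZ rho lT (@const_continuous R 1).
  apply: (aeS (aeI A (aeI B (aeI C (linear_operator0 lT))))) => t [A' [B' [C' D']]] tz.
  by rewrite -C' B'// -D' A'.
have fb : {ae mu, forall t, t <= zeta -> `|f u t| <= qr t}.
  have cf : continuous (freeze zeta u) by exact: freeze_continuous.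
  have fr s : `|freeze zeta u s| <= rho.
    apply: (@freezeP _ zeta u (fun x => `|x| <= rho)) => r /ub /andP[r0 rr].
    by rewrite ger0_norm.
  apply: (aeS (aeI (Hq _ cf fr) (Volterra_freeze zeta f_V cu))) => t [A B] tz.
  by rewrite -B.
apply: (aeS (aeI (bound _ ell0_lin ell0_pos ell0_V)
  (aeI (bound _ ell1_lin ell1_pos ell1_V) fb))) => t [A [B C]] tz.
have /andP[A0 A1] := A tz; have /andP[B0 B1] := B tz; have {}C := C tz.
rewrite /rhs (le_trans (ler_normD _ _))// lerD// (le_trans (ler_normB _ _))//.
by rewrite !ger0_norm// lerD.
Qed.

Definition truncate (T : R -> R) u s := Num.max 0 (Num.min (u s) (T s)).

Lemma truncate_continuous T u : continuous T -> continuous u -> continuous (truncate T u).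
Proof.
move=> cT cu; apply: continuous_max_fun; first exact: const_continuous.
exact: continuous_min_fun.
Qed.

Lemma truncate_dist T u v s : `|truncate T u s - truncate T v s| <= `|u s - v s|.
Proof.
have := ler_norm (u s - v s); have := ler_norm (v s - u s); rewrite [`|v s - _|]distrC.
rewrite ler_norml /truncate; case: (leP (u s) (T s)) => h1; case: (leP (v s) (T s)) => h2;
  case: (leP 0 (T s)) => h3; case: (leP 0 (u s)) => h4; case: (leP 0 (v s)) => h5; lra.
Qed.

(** The bound c gamma t <= u t gamma t0 stands in for positivity after t0: it does not depend on a
    and b, so it survives the limit, where strict positivity alone would be lost. *)
Lemma solution_on_interval a b c : a < t0 -> t0 < b -> 0 < c ->
  c <= kappa * expR (- M) ->
  exists u, [/\ continuous u, (forall s, s <= t0 -> 0 <= u s <= kappa), u t0 = c,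
    (forall t, t0 <= t -> t <= b -> c * gamma t <= u t * gamma t0) &
    (forall s t, a <= s -> s <= t -> t <= b -> u t - u s = intg (rhs u) s t)].
Proof.
move=> at0 tb c0 cM; have ab := ltW (lt_trans at0 tb).
have gg := gamma_gt0 gamma_AC.
pose E := expR (intg (ell0 (fun=> 1)) t0 b).
have [rho [g [rho0 Lg g0 qg Hrho]]] : exists (rho : R) (g : R -> R),
    [/\ 0 < rho, Lloc [set: R] g, (forall t, 0 <= g t),
     {ae mu, forall t, t0 <= t <= b -> q t rho <= g t} & E * (kappa + intg g t0 b) <= rho].
  by apply: Kloc_sublinear => //; [exact: expR_gt0|exact: ltW].
pose B := supersolution ell0 t0 kappa g.
have BL s : s <= t0 -> B s = kappa by exact: supersolution_left.
have cB : continuous B by exact: supersolution_continuous.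
have ndB s t : s <= t -> B s <= B t by exact: supersolution_nondecreasing.
(* Freezing B at b keeps the truncation below rho on all of R, so that a single majorant serves. *)
pose T s := B (Num.min s b).
have cT : continuous T by exact: (@freeze_continuous R b B).
have Tr s : T s <= rho by apply: le_trans Hrho; apply: ndB; rewrite ge_min lexx orbT.
have Tk s : kappa <= T s.
  have [st|ts] := leP (Num.min s b) t0; first by rewrite /T BL.
  by rewrite -(BL t0 (lexx _)) ndB// ltW.
have TE s : s <= b -> T s = B s by move=> sb; rewrite /T min_l.
have TL s : s <= t0 -> T s = kappa by move=> st; rewrite TE ?BL// (le_trans st)// ltW.
pose chi := truncate T.
have cchi u : continuous u -> continuous (chi u) by exact: truncate_continuous.
have chi0 u s : 0 <= chi u s by rewrite le_max lexx.
have chiT u s : chi u s <= T s.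
  by rewrite ge_max ge_min lexx orbT andbT (le_trans (ltW kappa_gt0)).
have chir u s : 0 <= chi u s <= rho by rewrite chi0 (le_trans (chiT _ _)).
pose Phi := rhs \o chi.
have [h Lh Hh] := rhs_majorant rho0.
have LPhi u : continuous u -> Lloc [set: R] (Phi u) by move=> cu; exact/rhs_Lloc/cchi.
have PhiL1 : L1_continuous Phi.
  by apply: L1_continuous_comp rhs_L1 => // u v s; exact: truncate_dist.
have PhiV zeta u v : continuous u -> continuous v -> (forall s, s <= zeta -> u s = v s) ->
    {ae mu, forall t, t <= zeta -> Phi u t = Phi v t}.
  move=> cu cv uv; apply: rhs_Volterra; [exact: cchi|exact: cchi|].
  by move=> s /uv; rewrite /chi /truncate => ->.
have Phih u : continuous u -> {ae mu, forall t, `|Phi u t| <= h t}.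
  move=> cu; have H (n : nat) : {ae mu, forall t, t <= n%:R -> `|Phi u t| <= h t}.
    by apply: Hh; [exact: cchi|move=> s _; exact: chir].
  apply: (aeS (ae_foralln H)) => t /(_ (Num.bound `|t|)); apply.
  exact: le_trans (ler_norm t) (ltW (archi_boundP (normr_ge0 t))).
have Phi0 u : continuous u -> (forall s, s <= t0 -> u s = 0) ->
    {ae mu, forall t, t <= t0 -> Phi u t = 0}.
  move=> cu u0; have c0' := @const_continuous R 0.
  have uv s : s <= t0 -> chi u s = (fun=> 0) s.
    move=> st; rewrite /chi /truncate u0// min_l ?maxxx//.
    exact: le_trans (ltW kappa_gt0) (Tk s).
  apply: (aeS (aeI (rhs_Volterra (cchi u cu) c0' uv) (aeI f0
    (aeI (linear_operator0 ell0_lin) (linear_operator0 ell1_lin))))) => t [A [F [G H]]] tt0.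
  by rewrite /Phi /= A// /rhs F// G H subrr addr0.
have [x [u [/andP[x0 xk] [uc ux] cu ua uE]]] := tonelli_shooting ab LPhi PhiL1 PhiV Lh Phih
  (ltW kappa_gt0) (ltW c0) Phi0.
pose v := chi u; have cv : continuous v by exact: cchi.
have LPsi := LPhi u cu.
have uI s t : a <= s -> s <= t -> t <= b -> u t - u s = intg (Phi u) s t.
  move=> as_ st tb'; rewrite uE ?(le_trans as_)// uE ?as_ ?(le_trans st)//.
  by rewrite (intg_cat LPsi as_ st); ring.
have vk s : s <= t0 -> v s <= kappa by move=> st; rewrite (le_trans (chiT u s))// TL.
have C0v : C0 `[0, +oo[ v.
  split => //; last by move=> s; rewrite /= in_itv/= andbT; exact: chi0.
  by apply: (@norm_le_bounded_fun R _ rho) => s; have /andP[? ?] := chir u s; rewrite ger0_norm.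
have fv : {ae mu, forall t, t <= t0 -> 0 <= f v t}.
  have C0f : C0 `[0, kappa] (freeze t0 v).
    have fk s : 0 <= freeze t0 v s <= kappa.
      by apply: (@freezeP _ t0 v (fun x => 0 <= x <= kappa)) => r rt; rewrite chi0 vk.
    split; first exact: freeze_continuous.
      by apply: (@norm_le_bounded_fun R _ kappa) => s; have /andP[? ?] := fk s; rewrite ger0_norm.
    by move=> s; rewrite /= in_itv/= fk.
  apply: (aeS (aeI (f_ge0 C0f) (Volterra_freeze t0 f_V cv))) => t [A D] tt0.
  by rewrite -D// A.
have l0v : {ae mu, forall t, 0 <= ell0 v t} by apply: ell0_pos => // s; exact: chi0.
(* Up to t0, ell0 v and f v are both nonnegative, by positivity and (i); afterwards their sum is, by
   (iii). *)
have Psi_ge : {ae mu, forall t, a <= t <= b -> - ell1 v t <= Phi u t}.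
  apply: (aeS (aeI fv (aeI l0v (ell0f_ge0 C0v vk)))) => t [A [D F]] _.
  rewrite /Phi /= /rhs -/v addrAC lerDr.
  have [/A ?|/ltW /F //] := leP t t0; exact: addr_ge0.
have vu s : s <= b -> v s <= Num.max (u s) 0.
  by move=> _; rewrite /v /chi /truncate ge_max !le_max lexx orbT/= ge_min lexx.
have quot := quotient_nondecreasing ell1_lin ell1_pos ell1_V gamma_AC gamma_der
  cu cv LPsi x0 ua vu uI Psi_ge.
have u0 s : s <= b -> 0 <= u s.
  move=> sb; have [sa|/ltW as_] := leP s a; first by rewrite ua.
  by rewrite -(pmulr_lge0 _ (gg a)) (le_trans _ (quot _ _ as_ sb))// ua// mulr_ge0// ltW.
have tb' := ltW tb.
have vE s : s <= t0 -> v s = Num.min (u s) kappa.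
  move=> st; rewrite /v /chi /truncate TL// max_r// le_min u0 ?(le_trans st)//=.
  exact: ltW.
have past s : a <= s -> s <= t0 -> u s * expR (- M) <= u t0.
  apply: (past_lower_bound ell1_lin ell1_pos ell1_V gamma_AC gamma_der ell0_lin ell0_pos
    ell0_V ell0_Vsigma kappa_gt0 ell0_gamma M_bound cu cv LPsi).
  - by move=> r rt; rewrite u0// (le_trans rt).
  - exact: vE.
  - by move=> r r' rr r't; apply: quot => //; exact: le_trans tb'.
  - by move=> r r' ar rr r't; apply: uI => //; exact: le_trans tb'.
  - by apply: (aeS fv) => t A /andP[_ tt0]; rewrite /Phi /= /rhs -/v lerDl A.
(* If x = kappa, the estimate [past] at s = a gives kappa e^-M <= u t0, hence c <= u t0. *)
have utc : u t0 = c.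
  move/eqP : ux; rewrite mulf_eq0 !subr_eq0 => /orP[/eqP //|/eqP xE].
  apply/eqP; rewrite eq_le uc/= (le_trans cM)//.
  by have := past a (lexx a) (ltW at0); rewrite ua// xE.
have uk s : s <= t0 -> u s <= kappa.
  have H r : a <= r -> r <= t0 -> u r <= kappa.
    move=> ar rt; have := le_trans (past r ar rt) (le_trans uc cM).
    by rewrite ler_pM2r// expR_gt0.
  have [sa _|/ltW as_] := leP s a; last exact: H.
  by rewrite ua// -(ua a (lexx a)) H// ltW.
have uleft s : s <= t0 -> 0 <= u s <= kappa.
  by move=> st; rewrite uk// u0// (le_trans st).
have uright t : t0 <= t -> t <= b -> c * gamma t <= u t * gamma t0.
  by move=> tt tb''; rewrite -utc; exact: quot.
have upos t : t0 <= t -> t <= b -> 0 < u t.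
  move=> tt tb''; rewrite -(pmulr_lgt0 _ (gg t0)) (lt_le_trans _ (uright t tt tb''))//.
  by rewrite mulr_gt0.
(* The truncation v is below B by construction, so the growth bound applies before u is known to be
   below B. *)
have uB t : t0 <= t -> t <= b -> u t <= B t.
  move=> tt ttb.
  suff : u t - u t0 <= B t - B t0 by rewrite (BL t0 (lexx _)) => H; have := uk t0 (lexx _); lra.
  apply: (@growth_bound _ _ _ _ _ _ ell0_lin ell0_pos ell0_V f_V kappa_gt0 q_nondecreasing
    f_sgn _ _ kappa_gt0 Lg g0 u v (Phi u) t rho) => //.
  - by move=> s st; rewrite chi0 vk.
  - move=> s /andP[ts st]; have sb := le_trans st ttb.
    by rewrite -/(B s) -TE// chiT andbT lt_max lt_min upos// (lt_le_trans kappa_gt0 (Tk s)) orbT.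
  - by rewrite -/(B t) -TE.
  - by apply: (aeS qg) => r A /andP[tr rt]; apply: A; rewrite tr (le_trans rt).
  - by move=> s r ts sr rt; apply: uI => //; [rewrite (le_trans (ltW at0))|exact: le_trans ttb].
  - have l1v : {ae mu, forall t, 0 <= ell1 v t} by apply: ell1_pos => // s; exact: chi0.
    by apply: (aeS l1v) => r A _; rewrite /Phi /= /rhs -/v lerD2r lerBlDr lerDl.
have vuE s : s <= b -> v s = u s.
  move=> sb; rewrite /v /chi /truncate min_l ?max_r ?u0//.
  have [st|/ltW ts] := leP s t0; first by rewrite TL// uk.
  by rewrite TE// uB.
exists u; split => // s t as_ st ttb; rewrite uI//.
apply: eq_intg => //; first exact: rhs_Lloc.
apply: (aeS (rhs_Volterra cv cu vuE)) => r A /andP[_ rt].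
by rewrite /Phi /= -/v A// (le_trans rt).
Qed.

Lemma continuous_lt_left u v a t : continuous u -> continuous v -> a < t ->
  (forall s, a <= s -> s < t -> u s < v s) -> u t <= v t.
Proof.
move=> cu cv at_ H; rewrite leNgt; apply/negP => vut.
have cw : (fun s => u s - v s) @ t --> u t - v t by apply: cvgB; [exact: cu|exact: cv].
have /nbhs_ballP[e /= e0 He] : \forall s \near t, 0 < u s - v s.
  by apply: (@cvgr_gt _ _ _ _ _ _ cw); rewrite subr_gt0.
pose s := Num.max a (t - e / 2).
have e2 : 0 < e / 2 by rewrite divr_gt0.
have st : s < t by rewrite gt_max at_ gtrBl.
have : 0 < u s - v s.
  apply: He; rewrite /ball/= gtr0_norm ?subr_gt0// ltrBlDr -ltrBlDl lt_max.
  by apply/orP; right; rewrite ltrD2l ltrN2 ltr_pdivrMr// ltr_pMr// ltr1n.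
by rewrite subr_gt0 ltNge ltW// H// le_max lexx.
Qed.

(* The bound rho depends on b only: on a maximal interval where u stays below
   the supersolution B with B t0 = kappa + 1, the growth bound gives u < B. *)
Lemma a_priori_bound b : t0 < b -> exists rho : R, forall u, continuous u ->
  (forall s, s <= t0 -> 0 <= u s <= kappa) ->
  (forall s, t0 <= s -> s <= b -> 0 < u s) ->
  (forall s t, t0 <= s -> s <= t -> t <= b -> u t - u s = intg (rhs u) s t) ->
  forall t, t0 <= t -> t <= b -> u t <= rho.
Proof.
move=> tb; pose E := expR (intg (ell0 (fun=> 1)) t0 b).
(* Starting B from kappa + 1 leaves a gap of at least 1 above u t0. *)
have k1 : 0 < kappa + 1 by rewrite addr_gt0.
have [rho [g [rho0 Lg g0 qg Hrho]]] : exists (rho : R) (g : R -> R),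
    [/\ 0 < rho, Lloc [set: R] g, (forall t, 0 <= g t),
     {ae mu, forall t, t0 <= t <= b -> q t rho <= g t} & E * (kappa + 1 + intg g t0 b) <= rho].
  by apply: Kloc_sublinear => //; [exact: expR_gt0|exact: ltW].
pose B := supersolution ell0 t0 (kappa + 1) g.
have Bt0 : B t0 = kappa + 1 by exact: supersolution_left.
have cB : continuous B by exact: supersolution_continuous.
have ndB s t : s <= t -> B s <= B t by exact: supersolution_nondecreasing.
exists rho => u cu uleft upos uE.
suff uB t : t0 <= t -> t <= b -> u t < B t.
  by move=> t tt ttb; rewrite (le_trans (ltW (uB t tt ttb)))// (le_trans _ Hrho)// ndB.
move=> tt ttb; rewrite ltNge; apply/negP => But.
pose S := [set r | [/\ t0 <= r, r <= t & B r <= u r]].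
have hS : has_inf S by split; [exists t|exists t0 => r []].
pose t1 := inf S.
have t01 : t0 <= t1 by apply: lb_le_inf; [exists t|move=> r []].
have t1t : t1 <= t by apply: inf_lbound; [exact: hS.2|].
have t1b := le_trans t1t ttb.
have before s : t0 <= s -> s < t1 -> u s < B s.
  move=> ts st1; rewrite ltNge; apply/negP => Bus.
  have : t1 <= s by apply: inf_lbound; [exact: hS.2|split=> //; exact: le_trans (ltW st1) t1t].
  by rewrite leNgt st1.
have Bu1 : B t1 <= u t1.
  rewrite leNgt; apply/negP => uB1.
  have cw : (fun s => B s - u s) @ t1 --> B t1 - u t1 by apply: cvgB; [exact: cB|exact: cu].
  have /nbhs_ballP[e /= e0 He] : \forall s \near t1, 0 < B s - u s.
    by apply: (@cvgr_gt _ _ _ _ _ _ cw); rewrite subr_gt0.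
  have [r Sr re] := inf_adherent e0 hS.
  have t1r : t1 <= r by apply: inf_lbound; [exact: hS.2|].
  have : 0 < B r - u r.
    by apply: He; rewrite /ball/= distrC ger0_norm ?subr_ge0// ltrBlDl.
  by case: Sr => _ _; rewrite subr_gt0 ltNge => ->.
have t01' : t0 < t1.
  rewrite lt_neqAle t01 andbT; apply/eqP => t0E; move: Bu1; rewrite -t0E Bt0.
  by have /andP[_] := uleft t0 (lexx _); lra.
have uB1 : u t1 <= B t1 by exact: continuous_lt_left before.
have l1u : {ae mu, forall r, r <= t1 -> 0 <= ell1 u r}.
  have A : {ae mu, forall r, r <= t1 -> ell1 (fun=> 0) r <= ell1 u r}.
    apply: positive_Volterra_le => //; first exact: const_continuous.
    move=> s st; have [/uleft/andP[]//|/ltW ts] := leP s t0.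
    by rewrite ltW// upos// (le_trans st).
  by apply: (aeS (aeI A (linear_operator0 ell1_lin))) => r [A1 A2] rt; rewrite -A2 A1.
have : u t1 - u t0 <= B t1 - B t0.
  apply: (@growth_bound _ _ _ _ _ _ ell0_lin ell0_pos ell0_V f_V kappa_gt0 q_nondecreasing
    f_sgn _ _ k1 Lg g0 u u (rhs u) t1 rho) => //.
  - exact: rhs_Lloc.
  - by rewrite lerDl.
  - move=> s /andP[ts st]; rewrite upos// ?(le_trans st)//=.
    by move: st; rewrite le_eqVlt => /predU1P[->//|st]; apply/ltW/before.
  - by rewrite (le_trans _ Hrho)// ndB.
  - by apply: (aeS qg) => r A /andP[tr rt]; apply: A; rewrite tr (le_trans rt).
  - by move=> s r ts sr rt; apply: uE => //; exact: le_trans t1b.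
  - by apply: (aeS l1u) => r A /andP[_ rt]; rewrite /rhs lerD2r lerBlDr lerDl A.
(* The gap B - u is at least 1 at t0 and has not shrunk at t1, which contradicts B t1 <= u t1. *)
by have /andP[_] := uleft t0 (lexx _); rewrite Bt0; lra.
Qed.

Lemma global_solution_exists c : 0 < c -> c <= kappa * expR (- M) ->
  exists u, [/\ global_solution ell0 ell1 f u, u t0 = c,
    forall t, t <= t0 -> 0 <= u t <= kappa & forall t, t0 <= t -> 0 < u t].
Proof.
move=> c0 cM.
have gg := gamma_gt0 gamma_AC.
have tn (n : nat) : t0 - n.+1%:R < t0 by rewrite gtrBl.
have tp (n : nat) : t0 < t0 + n.+1%:R by rewrite ltrDl.
have /choice[u_ Hu] := fun n : nat => solution_on_interval (tn n) (tp n) c0 cM.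
have cu n : continuous (u_ n) by have [] := Hu n.
have upos n t : t0 <= t -> t <= t0 + n.+1%:R -> 0 < u_ n t.
  move=> tt tb; have [_ _ _ H _] := Hu n.
  by rewrite -(pmulr_lgt0 _ (gg t0)) (lt_le_trans _ (H t tt tb))// mulr_gt0.
have /choice[rho Hrho] := fun m : nat => a_priori_bound (tp m).
(* [r m] bounds all [u_ n] with m <= n on ]-oo, t0 + m + 1]: kappa serves up to t0, [rho m] after
   it. *)
pose r m := Num.max kappa (rho m).
have r0 m : 0 < r m by rewrite lt_max kappa_gt0.
have ur m n t : (m <= n)%N -> t <= t0 + m.+1%:R -> 0 <= u_ n t <= r m.
  move=> mn tm; have [_ Hl _ _ HE] := Hu n.
  have [tt|/ltW tt] := leP t t0.
    by have /andP[-> tk] := Hl t tt; rewrite le_max tk.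
  have mn' : t0 + m.+1%:R <= t0 + n.+1%:R by rewrite lerD2l ler_nat.
  rewrite ltW ?upos// ?(le_trans tm)//= le_max; apply/orP; right.
  apply: (Hrho m) => //.
  - by move=> s ts sm; rewrite upos// (le_trans sm).
  - move=> s s' ts ss s'm; apply: HE => //; last exact: le_trans mn'.
    by rewrite (le_trans _ ts)// gerBl.
have big (N : R) : exists m : nat, t0 - m.+1%:R <= - N /\ N <= t0 + m.+1%:R.
  exists (Num.bound (`|N| + `|t0|)).
  have := archi_boundP (addr_ge0 (normr_ge0 N) (normr_ge0 t0)).
  set k := Num.bound _; rewrite -natr1 => H.
  have := ler_norm N; have := ler_norm t0; have := ler_norm (- t0); rewrite normrN.
  by split; lra.
have [||phi [u [cu' phij uu]]] := locally_uniform_subsequence cu.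
- move=> N; have [m [_ Nm]] := big N; exists (r m), m => n mn s /andP[_ sN].
  have /andP[s0 sr] := ur m n s mn (le_trans sN Nm).
  by rewrite ger0_norm.
- move=> N e e0; have [m [Nm' Nm]] := big N.
  have [h Lh Hh] := rhs_majorant (r0 m).
  have [d d0 Hd] := unif_continuous_itv (- N) N (@continuous_intg R h (- N) Lh) e0.
  exists d => //; exists m => n mn s t.
  wlog st : s t / s <= t.
    by move=> W sN tN; have [/W|/ltW /W] := leP s t; [exact|rewrite distrC [`|u_ n s - _|]distrC; exact].
  move=> /[dup] sN /andP[Ns sN'] /[dup] tN /andP[Nt tN'] std.
  have mn' : t0 + m.+1%:R <= t0 + n.+1%:R by rewrite lerD2l ler_nat.
  have mn'' : t0 - n.+1%:R <= t0 - m.+1%:R by rewrite lerD2l lerN2 ler_nat.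
  have [_ _ _ _ HE] := Hu n; rewrite distrC HE//; last 2 first.
  + by rewrite (le_trans mn'')// (le_trans Nm').
  + by rewrite (le_trans tN')// (le_trans Nm).
  have Lr := rhs_Lloc (cu n).
  apply: le_lt_trans (norm_intg _ _ Lr) _.
  apply: le_lt_trans (Hd t s tN sN _); last by rewrite distrC.
  apply: le_trans (ler_norm _).
  rewrite (intg_cat Lh Ns st) addrC addKr.
  apply: le_intg => //; first exact: Lloc_norm.
  apply: (aeS (Hh (u_ n) _ (cu n) (fun s => ur m n s mn))) => x A /andP[_ xt].
  by apply: A; rewrite (le_trans xt)// (le_trans tN').
have pw s := @locally_uniform_cvg_pointwise R _ _ s uu.
have Lr := rhs_Lloc cu'.
have uE s t : s <= t -> u t - u s = intg (rhs u) s t.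
  move=> st; have [m [ms mt]] := big (Num.max `|s| `|t|).
  have I1 := @L1_continuous_cvg R _ _ _ s t rhs_L1
    (fun v cv => rhs_Lloc cv) cu' (fun n => cu (phi n)) uu.
  have I2 : (u_ \o phi) n t - (u_ \o phi) n s @[n --> \oo] --> u t - u s.
    by apply: cvgB; exact: pw.
  apply: (cvg_unique (@Rhausdorff R) I2); apply: cvg_trans I1; apply: near_eq_cvg.
  (* As n <= phi n, from index m on the interval of the approximation contains [s, t], and its
     integral equation holds there exactly. *)
  exists m => // n /= mn; have [_ _ _ _ HE] := Hu (phi n).
  have mphi : (m <= phi n)%N by exact: leq_trans (phij n).
  rewrite /= HE//.
    rewrite (@le_trans _ _ (t0 - m.+1%:R)) ?lerD2l ?lerN2 ?ler_nat// (le_trans ms)// lerNl.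
    by rewrite le_max -normrN ler_norm.
  rewrite (@le_trans _ _ (t0 + m.+1%:R)) ?lerD2l ?ler_nat// (le_trans _ mt)//.
  by rewrite le_max ler_norm orbT.
have ut0 : u t0 = c.
  apply: (cvg_unique (@Rhausdorff R) (pw t0)).
  rewrite (_ : (fun n => _) = fun=> c); first exact: cvg_cst.
  by apply/funext => n /=; have [_ _ -> _ _] := Hu (phi n).
exists u; split => //.
- split; first exact: intg_ACloc Lr uE.
  exact: intg_is_derive Lr uE.
- move=> t tt; apply/andP; split.
    apply: (ler_cvg_to (cvg_cst 0) (pw t)); apply: nearW => n.
    by have [_ /(_ t tt)/andP[]] := Hu (phi n).
  apply: (ler_cvg_to (pw t) (cvg_cst kappa)); apply: nearW => n.
  by have [_ /(_ t tt)/andP[]] := Hu (phi n).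
- move=> t tt; rewrite -(pmulr_lgt0 _ (gg t0)) (@lt_le_trans _ _ (c * gamma t))//.
    by rewrite mulr_gt0.
  have [m [_ mt]] := big t.
  have I : u_ (phi n) t * gamma t0 @[n --> \oo] --> u t * gamma t0.
    by apply: cvgM; [exact: pw|exact: cvg_cst].
  apply: (ler_cvg_to (cvg_cst (c * gamma t)) I); exists m => // n /= mn.
  have [_ _ _ H _] := Hu (phi n); apply: H => //.
  by rewrite (le_trans mt)// lerD2l ler_nat ltnS (leq_trans mn).
Qed.

End existence.

Theorem theorem2p5 (R : realType) (ell0 ell1 f : (R -> R) -> R -> R)
    (t0 : R) (sigma : R -> R) (kappa : R) (q : R -> R -> R) (gamma : R -> R)
    (* standing assumptions *)
    (ell0_cont : continuous_operator ell0)
    (ell0_lin : linear_operator ell0)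
    (ell0_pos : positive_operator ell0)
    (ell1_cont : continuous_operator ell1)
    (ell1_lin : linear_operator ell1)
    (ell1_pos : positive_operator ell1)
    (f_cont : continuous_operator f)
    (f_Car : local_Caratheodory f)
    (* Volterra assumptions *)
    (ell0_V : Volterra ell0) (ell1_V : Volterra ell1) (f_V : Volterra f)
    (sigma_delay : delay sigma)
    (ell0_Vsigma : Volterra_delay_upto t0 sigma ell0)
    (f0 : {ae @lebesgue_measure R, forall t, t <= t0 -> f (fun=> 0) t = 0})
    (kappa_gt0 : 0 < kappa)
    (* (i) *)
    (f_ge0 : forall v, C0 `[0, kappa] v ->
       {ae @lebesgue_measure R, forall t, t <= t0 -> 0 <= f v t})
    (* (ii) *)
    (q_Kloc : Kloc t0 q)
    (q_nondecreasing : forall t x y : R,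
       t0 <= t -> 0 <= x -> x <= y -> q t x <= q t y)
    (q_lim : forall b : R, t0 < b ->
       ((x^-1)%:E * \int[@lebesgue_measure R]_(s in `[t0, b]) (q s x)%:E)%E
         @[x --> +oo] --> 0%E)
    (f_sgn : forall v, C0 [set: R] v ->
       0 <= v t0 <= kappa ->
       (forall t : R, t <= t0 -> - kappa <= v t <= kappa) ->
       {ae @lebesgue_measure R, forall t, t0 <= t ->
          f v t * Num.sg (v t) <= q t (supnorm v)})
    (* (iii) *)
    (ell0f_ge0 : forall v, C0 `[0, +oo[ v ->
       (forall t : R, t <= t0 -> v t <= kappa) ->
       {ae @lebesgue_measure R, forall t, t0 <= t -> 0 <= ell0 v t + f v t})
    (gamma_AC : ACloc [set: R] `]0, +oo[ gamma)
    (gamma_der : {ae @lebesgue_measure R, forall t,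
       derive1 gamma t <= - ell1 gamma t})
    (ell0_gamma : {ae @lebesgue_measure R, forall t, t <= t0 ->
       ell1 gamma t / gamma t <= ell0 (fun=> 1) t})
    (M_fin : (M_sigma t0 sigma ell1 gamma < +oo)%E) :
  forall c : R,
    0 < c <= kappa * expR (- fine (M_sigma t0 sigma ell1 gamma)) ->
    exists u : R -> R,
      [/\ global_solution ell0 ell1 f u,
          u t0 = c,
          forall t, t <= t0 -> 0 <= u t <= kappa &
          forall t, t0 <= t -> 0 < u t].
Proof.
have Lp := gamma_ratio_Lloc ell1_V gamma_AC.
have M_ub t : t <= t0 -> ((intg (fun s => ell1 gamma s / gamma s) (sigma t) t)%:E <=
    M_sigma t0 sigma ell1 gamma)%E.
  move=> tt; rewrite /intg /Rintegral fineK; last first.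
    by apply: integrable_fin_num => //; exact: Lloc_itv.
  by apply: ereal_sup_ubound; exists t; rewrite //= in_itv.
(* The supremum is also bounded below, by the integral at t = t0, so [fine] returns its true value
   and not a default. *)
have M_num : M_sigma t0 sigma ell1 gamma \is a fin_num.
  by rewrite fin_numElt M_fin andbT (lt_le_trans _ (M_ub t0 (lexx _)))// ltNyr.
move=> c /andP[c0 cM]; apply: (global_solution_exists ell0_lin ell0_pos ell1_lin ell1_pos
  f_Car ell0_V ell1_V f_V ell0_Vsigma f0 kappa_gt0 f_ge0 q_Kloc q_nondecreasing q_lim
  f_sgn ell0f_ge0 gamma_AC gamma_der ell0_gamma _ c0 cM).
by move=> t tt; rewrite -lee_fin (fineK M_num) M_ub.
Qed.
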